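(* Let $p(\cdot)\in P^{\log}(\mathbb{R})$ with $1<p^-\le p^+<\infty$, let $1\le q<\infty$, let $w\in A_{p(\cdot)}$ be a weight on $\mathbb{R}$, and assume that the Hardy–Littlewood maximal operator $M$ is bounded on the amalgam space $(L_w^{p(\cdot)},\ell^q)$. Then a family $\mathcal{F}\subset (L_w^{p(\cdot)},\ell^q)$ is totally bounded in $(L_w^{p(\cdot)},\ell^q)$ if and only if the following three conditions hold: (i) $\mathcal{F}$ is bounded in $(L_w^{p(\cdot)},\ell^q)$, i.e. $\sup_{f\in\mathcal{F}}\|f\|_{(L_w^{p(\cdot)},\ell^q)}<\infty$; (ii) $\lim_{r\to0^+}\|f-(f)_{B(\cdot,r)}\|_{(L_w^{p(\cdot)},\ell^q)}=0$ uniformly for $f\in\mathcal{F}$, i.e. for every $\varepsilon>0$ there is $\delta>0$ such that $\|f-(f)_{B(\cdot,r)}\|_{(L_w^{p(\cdot)},\ell^q)}<\varepsilon$ for all $0<r<\delta$ and all $f\in\mathcal{F}$, where $(f)_{B(x,r)}=\frac1{|B(x,r)|}\int_{B(x,r)}f(t)\,dt$; (iii) for every $\varepsilon>0$ there is a $\gamma>0$ such that for all $f\in\mathcal{F}$, $\|f\,\chi_{\{|x|>\gamma\}}\|_{(L_w^{p(\cdot)},\ell^q)}<\varepsilon$.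
   Context: All functions are on $\mathbb{R}$ (functions equal a.e. are identified). A variable exponent is a measurable $p(\cdot):\mathbb{R}\to[1,\infty)$; $p^-=\operatorname{ess\,inf}p$, $p^+=\operatorname{ess\,sup}p$. $P^{\log}(\mathbb{R})$ is the class of exponents for which there are $C>0$ and $p_\infty>1$ with $|p(x)-p(y)|\le C/\log(e+1/|x-y|)$ and $|p(x)-p_\infty|\le C/\log(e+|x|)$ for all $x,y$. A weight is a measurable, locally integrable function $w:\mathbb{R}\to(0,\infty)$. For a measurable function $f$, $\|f\|_{p(\cdot)}=\inf\{\lambda>0:\int|f(x)/\lambda|^{p(x)}dx\le1\}$, and $L_w^{p(\cdot)}(\mathbb{R})$ is the space of measurable $f$ with $\|f\|_{L_w^{p(\cdot)}(\mathbb{R})}=\|f w^{1/p(\cdot)}\|_{p(\cdot)}<\infty$. $w\in A_{p(\cdot)}$ means $\sup_{B}|B|^{-p_B}\|w\|_{L^1(B)}\left\|\frac1w\right\|_{L^{p'(\cdot)/p(\cdot)}(B)}<\infty$, the supremum over all balls $B$, where $p_B=\left(\frac1{|B|}\int_B\frac{dx}{p(x)}\right)^{-1}$, $\frac1{p(\cdot)}+\frac1{p'(\cdot)}=1$, and $\|\cdot\|_{L^{s(\cdot)}(B)}$ denotes the expression $\inf\{\lambda>0:\int_B|f/\lambda|^{s(x)}dx\le1\}$ (also when $s$ takes values below $1$). Amalgam space: $L^{p(\cdot)}_{loc,w}(\mathbb{R})$ is the space of functions $f$ with $f\chi_K\in L_w^{p(\cdot)}(\mathbb{R})$ for every compact $K$.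 With $J_k=[k,k+1)$, $(L_w^{p(\cdot)},\ell^q)$ is the Banach space of $f\in L^{p(\cdot)}_{loc,w}(\mathbb{R})$ with $\|f\|_{(L_w^{p(\cdot)},\ell^q)}=\left(\sum_{k\in\mathbb{Z}}\|f\chi_{J_k}\|_{L_w^{p(\cdot)}(\mathbb{R})}^q\right)^{1/q}<\infty$. Maximal operator: $Mf(x)=\sup_{r>0}\frac1{|B(x,r)|}\int_{B(x,r)}|f(y)|dy$, with $B(x,r)$ the open ball (interval) of center $x$ and radius $r$; boundedness means $\|Mf\|\le C\|f\|$ in the given norm. A set is totally bounded if for every $\varepsilon>0$ it has a finite $\varepsilon$-net. *)

(* Defs.v *)
(* MathComp-Analysis; functions on the line are functions on an arbitrary
   realType R, with Lebesgue measure. *)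
From HB Require Import structures.
From mathcomp Require Import all_boot all_order all_algebra.
From mathcomp Require Import all_classical all_reals all_analysis.
From mathcomp Require Import ess_sup_inf.

Set Implicit Arguments.
Unset Strict Implicit.
Unset Printing Implicit Defensive.
Import Order.TTheory GRing.Theory Num.Theory.
Import numFieldNormedType.Exports.

Local Open Scope classical_set_scope.
Local Open Scope ring_scope.

Section variable_exponent.
Context {R : realType}.
Local Notation mu := (@lebesgue_measure R).
Implicit Types (q : R) (p s w f g : R -> R) (h : R -> \bar R) (A B K : set R).

Definition variable_exponent p :=
  measurable_fun [set: R] p /\ forall x, 1 <= p x.

Definition exponent_inf p : \bar R := ess_inf mu (EFin \o p).
Definition exponent_sup p : \bar R := ess_sup mu (EFin \o p).

(* At x = y the quotient 1 / `|x - y| is 0 by convention; the first inequality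
   then reads 0 <= C and imposes nothing. *)
Definition log_holder p := exists C pinfty : R,
  [/\ 0 < C, 1 < pinfty,
      forall x y, `|p x - p y| <= C / ln (expR 1 + 1 / `|x - y|) &
      forall x, `|p x - pinfty| <= C / ln (expR 1 + `|x|)].

Definition Plog p := variable_exponent p /\ log_holder p.

Definition weight w :=
  (forall x, 0 < w x) /\ locally_integrable [set: R] w.

(* The argument h is extended-real valued because the maximal function is, and
   nothing is assumed on s, which takes values below 1 in the A_p(.)
   condition. *)
Definition luxemburg A s h : \bar R :=
  ereal_inf [set l%:E | l in [set l : R | 0 < l /\
    (\int[mu]_(x in A) (`|h x| * (l^-1)%:E) `^ s x <= 1)%E]].

Definition wnorm p w h : \bar R :=
  luxemburg [set: R] p (fun x => h x * (w x `^ (p x)^-1)%:E)%E.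

Definition conjugate_exponent p : R -> R := fun x => (1 - (p x)^-1)^-1.

Definition pball p A : R :=
  ((fine (mu A))^-1 * \int[mu]_(x in A) (p x)^-1)^-1.

Definition Apx_quantity p w A : \bar R :=
  ((fine (mu A) `^ (- pball p A))%:E * (\int[mu]_(x in A) `|w x|%:E) *
   luxemburg A (fun x => (conjugate_exponent p x / p x)%R)
     (fun x => ((w x)^-1)%:E))%E.

Definition Apx p w :=
  let balls := [set B : set R | exists x r, 0 < r /\ B = ball x r] in
  (ereal_sup [set Apx_quantity p w B | B in balls] < +oo)%E.

Definition unit_cell (k : int) : set R := `[k%:~R, (k + 1)%:~R[%classic.

Definition amalgam_norm p q w h : \bar R :=
  ((\esum_(k in [set: int]) (wnorm p w (h \_ (unit_cell k)) `^ q)) `^ q^-1)%E.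

(* Functions agreeing a.e. are not quotiented out: elements of the space are
   represented by Borel functions, and amalgam_norm only depends on the a.e.
   class. *)
Definition amalgam p q w : set (R -> R) := [set f : R -> R |
  [/\ measurable_fun [set: R] f,
      forall K, compact K -> (wnorm p w ((EFin \o f) \_ K) < +oo)%E &
      (amalgam_norm p q w (EFin \o f) < +oo)%E]].

Definition HL_bounded_on_amalgam p q w := exists C : R, forall f,
  amalgam p q w f ->
  (amalgam_norm p q w (HL_maximal f) <=
     C%:E * amalgam_norm p q w (EFin \o f))%E.

Definition average f (x r : R) : R :=
  (fine (mu (ball x r)))^-1 * \int[mu]_(t in ball x r) f t.

Definition totally_bounded_amalgam p q w (F : set (R -> R)) :=
  forall eps : R, 0 < eps -> exists N : set (R -> R),
    [/\ finite_set N, N `<=` amalgam p q w &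
        forall f, F f -> exists2 g, N g &
          (amalgam_norm p q w (fun x => (f x - g x)%:E) < eps%:E)%E].

End variable_exponent.

(* Main.v *)
(* Constants being irrelevant here, a quasi-triangle inequality for the amalgam
   norm suffices.  It comes with a dominated convergence theorem, used in each
   cell for the modular and then for the l^q sum over cells.

   Averages are dominated by the maximal function, f - (f)_{B(.,r)} by
   |f| + M f, and (f)_{B(x,r)} tends to f(x) at Lebesgue points; so boundedness
   of M and dominated convergence give (ii) for a single f, and (iii) for a
   single f is dominated convergence again.  Both pass from a finite net to F,
   the averages of f - g being controlled by M (f - g).

   Conversely, p is continuous, hence p >= c > 1 everywhere, and A_{p(.)} makes
   sigma = w^{-1/(p-1)} locally integrable.  The pointwise inequality
   t <= eta t^p w + eta^{-1/(c-1)} sigma turns a norm bound into local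
   equi-integrability, so the averages at a fixed radius are uniformly bounded
   and equicontinuous on [-n, n].  Rounding their values at finitely many points
   maps F to a finite set, and picking one element of F in each fibre yields the
   net: f and g in the same fibre are close because their averages are. *)
Require Import Defs.
From mathcomp Require Import all_boot all_order all_algebra.
From mathcomp Require Import all_classical all_reals all_analysis.
From mathcomp Require Import finmap measurable_realfun ess_sup_inf ring lra.

Set Implicit Arguments.
Unset Strict Implicit.
Unset Printing Implicit Defensive.
Import Order.TTheory GRing.Theory Num.Theory.
Import numFieldNormedType.Exports.

Local Open Scope classical_set_scope.
Local Open Scope ring_scope.

(** * Measurability of variable powers, rounding, and finite selections *)

Lemma measurable_powR_variable d (T : measurableType d) (R : realType)
    (f p : T -> R) :
  measurable_fun setT f -> measurable_fun setT p ->
  measurable_fun setT (fun x => f x `^ p x).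
Proof.
move=> mf mp; rewrite /powR; apply: measurable_fun_ifT => /=.
- exact: measurable_fun_eqr.
(* At base 0 the power is 1 where the exponent vanishes and 0 elsewhere. *)
- rewrite [X in measurable_fun _ X](_ : _ = fun x => if p x == 0 then 1 else 0).
    apply: measurable_fun_ifT => //=.
    exact: measurable_fun_eqr.
  by apply/funext => x; case: eqP.
- apply: measurableT_comp => //; apply: measurable_funM => //.
  exact: measurableT_comp.
Qed.

(** A positive exponent sends [+oo] to [+oo], so the infinite values split off and the rest is the
    real-valued case. *)
Lemma measurable_poweR_variable d (T : measurableType d) (R : realType)
    (f : T -> \bar R) (p : T -> R) :
  (forall x, 0 <= f x)%E -> (forall x, 0 < p x) ->
  measurable_fun setT f -> measurable_fun setT p ->
  measurable_fun setT (fun x => (f x `^ p x)%E).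
Proof.
move=> f0 p0 mf mp.
rewrite [X in measurable_fun _ X](_ : _ =
    fun x => if f x == +oo%E then +oo%E else (fine (f x) `^ p x)%:E).
  apply: measurable_fun_ifT => //=; first exact: measurable_fun_eqe.
  apply: measurableT_comp => //; apply: measurable_powR_variable => //.
  exact: measurableT_comp.
apply/funext => x; have := f0 x; case: (f x) => //= _.
by rewrite gt_eqF.
Qed.

Lemma measurable_inv d (T : measurableType d) (R : realType) (f : T -> R) :
  (forall x, 0 < f x) -> measurable_fun setT f ->
  measurable_fun setT (fun x => (f x)^-1).
Proof.
move=> f0 mf; rewrite (_ : (fun x => _) = fun x => f x `^ (-1)).
  exact: measurable_powR_variable.
by apply/funext => x; rewrite powR_inv1// ltW.
Qed.

Lemma nat_gt (R : realType) (x : R) : exists m : nat, x < m%:R.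
Proof.
exists (Num.bound `|x|); apply: le_lt_trans (ler_norm x) _.
exact: archi_boundP.
Qed.

Lemma truncn_eq_dist (R : realType) (x y : R) : (0 <= x) -> (0 <= y) ->
  Num.truncn x = Num.truncn y -> (`|x - y| <= 1).
Proof.
move=> /truncn_itv/andP[x1 x2] /truncn_itv/andP[y1 y2] xy.
rewrite xy -natr1 in x1 x2; rewrite -natr1 in y2.
by rewrite ler_norml; apply/andP; split; lra.
Qed.

Lemma normr_distr3 (R : realFieldType) (a b a' b' e : R) :
  (`|a - b| <= e / 3) -> (`|a' - b'| <= e / 3) -> (`|b - b'| <= e / 3) ->
  (`|a - a'| <= e).
Proof. by rewrite !ler_norml => ? ? ?; apply/andP; split; lra. Qed.

(** A net extracted from a finite colouring: one representative is chosen in each fibre of [Phi]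
    that meets [F]. *)
Lemma finite_type_net (I : finType) (T : pointedType) (F : set T) (Phi : T -> I)
    (Q : T -> T -> Prop) :
  (forall f g, F f -> F g -> Phi f = Phi g -> Q f g) ->
  exists N : set T, [/\ finite_set N, N `<=` F &
    forall f, F f -> exists2 g, N g & Q f g].
Proof.
move=> PhiQ; pose rep i : T := xget point [set f | F f /\ Phi f = i].
(* On an empty fibre [xget] returns the default [point]; intersecting with [F] discards it if it
   lies outside [F]. *)
exists ((rep @` [set: I]) `&` F); split.
- by apply: finite_setIl; apply: finite_image; exact: finite_finset.
- by move=> g [].
move=> f Ff; have [] : [set f' | F f' /\ Phi f' = Phi f] (rep (Phi f)).
  by apply: (@xgetI _ _ _ f).
move=> Fr rf; exists (rep (Phi f)).
  by split => //; exists (Phi f).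
exact: PhiQ.
Qed.

(** Turns a threshold for each cell, or for each element of a net, into a common one. *)
Lemma near_finite_set T (F : set_system T) (I : choiceType) (A : set I)
    (Q : I -> set T) : Filter F -> finite_set A ->
  (forall k, A k -> F (Q k)) -> F [set n | forall k, A k -> Q k n].
Proof.
move=> FF finA AQ.
have /(@filter_bigI _ _ _ _ _ FF) : forall k, k \in fset_set A -> F (Q k).
  by move=> k; rewrite in_fset_set// => /set_mem; exact: AQ.
by apply: filterS => n + k Ak; apply; rewrite /= in_fset_set//; exact: mem_set.
Qed.

(** * Inequalities for extended-real powers and sums *)

Section extended_reals.
Local Open Scope ereal_scope.

Lemma poweR_le (R : realType) (x y : \bar R) r :
  (0 <= r)%R -> 0 <= x -> x <= y -> x `^ r <= y `^ r.
Proof.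
move=> r0 x0 xy; apply: gt0_ler_poweR => //; rewrite in_itv/= leey andbT//.
exact: le_trans xy.
Qed.

Lemma poweR_le_self (R : realType) (a : \bar R) r :
  0 <= a -> a <= 1 -> (1 <= r)%R -> a `^ r <= a.
Proof.
move: a => [a|//|//]; rewrite poweR_EFin !lee_fin => a0 a1 r1.
have [->|aN0] := eqVneq a 0%R.
  by rewrite powR0// gt_eqF// (lt_le_trans ltr01).
by apply: ge1r_powR => //; rewrite a1 lt0r aN0 a0.
Qed.

Lemma cvge0_lt (R : realType) (u : (\bar R)^nat) (e : R) :
  u @ \oo --> 0 -> (0 < e)%R ->
  \forall n \near \oo, u n < e%:E.
Proof.
move=> u0 e0; apply: (u0 [set y | y < e%:E]).
exact: (@nbhs_open_ereal_lt _ _ (cst e)).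
Qed.

Lemma ge0_lty_EFin (R : realType) (x : \bar R) : 0 <= x -> x < +oo ->
  exists2 K : R, (0 < K)%R & x < K%:E.
Proof.
case: x => [x| |]//; rewrite lee_fin => x0 _.
by exists (x + 1)%R; rewrite ?lte_fin ?ltrDl// ltr_wpDl.
Qed.

Lemma le_abse_restrict (R : realType) (h g1 g2 : R -> \bar R) A :
  (forall x, `|h x| <= `|g1 x| + `|g2 x|) ->
  forall x, `|(h \_ A) x| <= `|(g1 \_ A) x| + `|(g2 \_ A) x|.
Proof.
by move=> hg x; rewrite /patch; case: ifP => // _; rewrite !abse0 adde0.
Qed.

Lemma fsum_le_cst (R : realType) (I : choiceType) (A : set I)
    (a : I -> \bar R) (b : R) :
  finite_set A -> (forall k, A k -> a k <= b%:E) ->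
  \sum_(k \in A) a k <= (b *+ #|` fset_set A|%fset)%:E.
Proof.
move=> finA ab; apply: (@le_trans _ _ (\sum_(k \in A) b%:E)).
  exact: lee_fsum.
by rewrite fsbig_finite//= sumEFin big_const_seq count_predT iter_addr_0.
Qed.

Lemma esum_le_mul (R : realType) (T : choiceType) (A : set T)
    (a b : T -> \bar R) (c : R) :
  (0 <= c)%R -> (forall k, 0 <= b k) -> (forall k, A k -> a k <= c%:E * b k) ->
  \esum_(k in A) a k <= c%:E * \esum_(k in A) b k.
Proof.
move=> c0 b0 ab; apply: ge_ereal_sup => _ [X [finX XA] <-].
apply: (@le_trans _ _ (c%:E * \sum_(k \in X) b k)).
  by rewrite ge0_mule_fsumr//; apply: lee_fsum => // k Xk; exact/ab/XA.
apply: lee_wpmul2l; first by rewrite lee_fin.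
by apply: ereal_sup_ubound; exists X.
Qed.

(** The sum is a finite supremum of finite partial sums; one within [e] of it leaves at most [e] on
    the complement. *)
Lemma esum_tail (R : realType) (T : choiceType) (a : T -> \bar R) (e : R) :
  (forall k, 0 <= a k) -> \esum_(k in setT) a k < +oo -> (0 < e)%R ->
  exists2 A : set T, finite_set A & \esum_(k in ~` A) a k <= e%:E.
Proof.
move=> a0 aoo e0.
have afin : \esum_(k in setT) a k \is a fin_num.
  by rewrite ge0_fin_numE// esum_ge0.
have [_ [A [finA _] <-]] := ub_ereal_sup_adherent e0 afin.
rewrite -/(esum _ _) (esumID A) ?setTI// => h; exists A => //; move: h.
rewrite -esum_fset//.
have Afin : \esum_(k in A) a k \is a fin_num.
  rewrite ge0_fin_numE ?esum_ge0//; apply: le_lt_trans aoo.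
  by rewrite [leRHS](esumID A)// setTI leeDl// esum_ge0.
by rewrite lteBlDr// lteD2lE// => /ltW.
Qed.

End extended_reals.

Lemma luxemburg_ge0 (R : realType) (A : set R) s h : (0 <= luxemburg A s h)%E.
Proof. by apply: le_ereal_inf_tmp => _ [l [/ltW l0 _] <-]; rewrite lee_fin. Qed.

(** * The modular and the weighted Luxemburg norm *)

Section modular.
Context {R : realType}.
Local Notation mu := (@lebesgue_measure R).
Local Open Scope ereal_scope.
Variables (p w : R -> R) (P : R).
Hypotheses (mp : measurable_fun [set: R] p) (p1 : forall x, (1 <= p x)%R)
  (pP : forall x, (p x <= P)%R).
Hypotheses (mw : measurable_fun [set: R] w) (w0 : forall x, (0 < w x)%R).

Let p_gt0 x : (0 < p x)%R. Proof. exact: lt_le_trans (p1 x). Qed.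

(** The factor [w^(1/p)] of the norm, once raised to the power [p], becomes a plain factor [w]
    outside the power. *)
Definition modular_density (h : R -> \bar R) (l : R) x : \bar R :=
  (`|h x| * (l^-1)%:E) `^ p x * (w x)%:E.

Lemma modular_density_ge0 h l x : 0 <= modular_density h l x.
Proof. by rewrite mule_ge0 ?poweR_ge0// lee_fin ltW. Qed.

Lemma measurable_modular_density h l : (0 < l)%R ->
  measurable_fun setT h -> measurable_fun setT (modular_density h l).
Proof.
move=> l0 mh; apply: emeasurable_funM; last exact/measurable_EFinP.
apply: measurable_poweR_variable => //.
  by move=> x; rewrite mule_ge0// lee_fin invr_ge0 ltW.
by apply: emeasurable_funM => //; exact: measurableT_comp.
Qed.

Lemma modular_density_restrict h l A :
  modular_density (h \_ A) l = modular_density h l \_ A.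
Proof.
apply/funext => x; rewrite /modular_density /patch; case: ifP => //= _.
by rewrite normr0 mul0r powR0 ?gt_eqF// mul0e.
Qed.

Definition modular h l : \bar R := \int[mu]_x modular_density h l x.

Lemma wnormE h : wnorm p w h =
  ereal_inf [set l%:E | l in [set l : R | (0 < l)%R /\ modular h l <= 1]].
Proof.
rewrite /wnorm /luxemburg.
set A := [set l : R | _]; set B := [set l : R | _]; suff -> : A = B by [].
suff H l : (0 < l)%R -> modular h l = \int[mu]_x
    (`|h x * (w x `^ (p x)^-1)%:E| * (l^-1)%:E) `^ p x.
  by apply/seteqP; split=> l [l0 hl]; split=> //; move: hl; rewrite /= H.
move=> l0; apply: eq_integral => x _; rewrite /modular_density.
rewrite abseM /= (ger0_norm (powR_ge0 _ _)) muleAC [in RHS]poweRM; last 2 first.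
- by rewrite mule_ge0// lee_fin invr_ge0 ltW.
- by rewrite lee_fin powR_ge0.
congr (_ * _); rewrite poweR_EFin -powRrM mulVf ?gt_eqF//.
by rewrite powRr1// ltW.
Qed.

Lemma wnorm_ge0 h : 0 <= wnorm p w h. Proof. exact: luxemburg_ge0. Qed.

Lemma wnorm_le_modular h l : (0 < l)%R -> modular h l <= 1 ->
  wnorm p w h <= l%:E.
Proof. by move=> l0 hl; rewrite wnormE; apply: ereal_inf_lbound; exists l. Qed.

Lemma modular_density_le h g l l' x : (0 < l)%R -> (l <= l')%R ->
  `|h x| <= `|g x| -> modular_density h l' x <= modular_density g l x.
Proof.
move=> l0 ll' hg; apply: lee_wpmul2r; first by rewrite lee_fin ltW.
apply: poweR_le; first exact: ltW.
- by rewrite mule_ge0// lee_fin invr_ge0 ltW// (lt_le_trans l0).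
rewrite lee_pmul// ?lee_fin ?invr_ge0 ?(ltW (lt_le_trans l0 _))//.
by rewrite lef_pV2// posrE (lt_le_trans l0).
Qed.

Lemma modular_le h g l l' : (0 < l)%R -> (l <= l')%R ->
  measurable_fun setT h -> measurable_fun setT g ->
  (forall x, `|h x| <= `|g x|) -> modular h l' <= modular g l.
Proof.
move=> l0 ll' mh mg hg; apply: ge0_le_integral => //.
- by move=> x _; exact: modular_density_ge0.
- by apply: measurable_modular_density => //; exact: lt_le_trans ll'.
- exact: measurable_modular_density.
- by move=> x _; exact: modular_density_le.
Qed.

(** The modular decreases in [l], so every [l] strictly above the infimum is admissible. Strictness
    spares the question whether the infimum is attained. *)
Lemma wnorm_lt_modular (h : R -> \bar R) l : measurable_fun setT h ->
  wnorm p w h < l%:E -> (0 < l)%R /\ modular h l <= 1.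
Proof.
move=> mh; rewrite wnormE => /ereal_inf_lt[_ [l' [l'0 hl'] <-]].
rewrite lte_fin => l'l; split; first exact: lt_trans l'l.
by apply: le_trans hl'; apply: modular_le => //; exact: ltW.
Qed.

(* The crude constant 4 spares the convexity of the modular. *)
Lemma wnorm_quasi_triangle (h g1 g2 : R -> \bar R) l :
  measurable_fun setT h -> measurable_fun setT g1 -> measurable_fun setT g2 ->
  (forall x, `|h x| <= `|g1 x| + `|g2 x|) ->
  wnorm p w g1 <= l%:E -> wnorm p w g2 <= l%:E -> wnorm p w h <= (4 * l)%:E.
Proof.
move=> mh mg1 mg2 hg g1l g2l; apply/lee_addgt0Pr => e e0.
(* Slightly above [l], so that both modulars at [l'] are at most 1; the excess is [e] once
   multiplied by 4. *)
pose l' := (l + e / 4)%R.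
have ll' : l%:E < l'%:E by rewrite lte_fin ltrDl divr_gt0.
have [l'0 {}g1l] := wnorm_lt_modular mg1 (le_lt_trans g1l ll').
have [_ {}g2l] := wnorm_lt_modular mg2 (le_lt_trans g2l ll').
rewrite -EFinD (_ : 4 * l + e = 4 * l')%R; last by rewrite /l'; field.
apply: wnorm_le_modular; first by rewrite mulr_gt0.
pose D (g : R -> \bar R) x := 2^-1%:E * modular_density g l' x.
have D0 g x : 0 <= D g x by rewrite mule_ge0 ?modular_density_ge0// lee_fin.
have mD g : measurable_fun setT g -> measurable_fun setT (D g).
  by move=> mg; apply: measurable_funeM; exact: measurable_modular_density.
have intD g : measurable_fun setT g -> modular g l' <= 1 ->
    \int[mu]_x D g x <= 2^-1%:E.
  move=> mg gl; rewrite ge0_integralZl//.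
  - by rewrite -[leRHS]mule1 lee_wpmul2l// lee_fin.
  - exact: measurable_modular_density.
  - by move=> x _; exact: modular_density_ge0.
apply: (@le_trans _ _ (\int[mu]_x (D g1 x + D g2 x))); last first.
  rewrite ge0_integralD//; try exact: mD.
  apply: (le_trans (leeD (intD _ mg1 g1l) (intD _ mg2 g2l))).
  by rewrite -EFinD lee_fin; lra.
apply: ge0_le_integral => //.
- by move=> x _; exact: modular_density_ge0.
- by apply: measurable_modular_density => //; rewrite mulr_gt0.
- by apply: emeasurable_funD; exact: mD.
(* Dividing by [4 * l'] absorbs the factor 2 and leaves a spare 1/2, whose [p x]-th power is at most
   1/2 because [p x >= 1]. *)
have key g x : `|h x| <= 2%:E * `|g x| ->
    modular_density h (4 * l') x <= D g x.
  move=> hg'; rewrite /D /modular_density muleA.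
  apply: lee_wpmul2r; first by rewrite lee_fin ltW.
  apply: (@le_trans _ _ ((2^-1%:E * (`|g x| * (l'^-1)%:E)) `^ p x)).
    apply: poweR_le; first exact: ltW.
      by rewrite mule_ge0// lee_fin invr_ge0 mulr_ge0// ltW.
    rewrite [leRHS]muleCA -EFinM
      (_ : (4 * l')^-1 = 2^-1 * (2^-1 * l'^-1))%R; last first.
      by field; rewrite gt_eqF.
    rewrite [in leLHS]EFinM [leLHS]muleA.
    apply: lee_wpmul2r; first by rewrite lee_fin mulr_ge0// invr_ge0 ltW.
    rewrite -(@lee_pmul2r _ 2%:E)// -muleA -EFinM mulVf// mule1.
    by rewrite muleC.
  rewrite poweRM ?lee_fin ?invr_ge0//; last first.
    by rewrite mule_ge0// lee_fin invr_ge0 ltW.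
  rewrite lee_wpmul2r ?poweR_ge0// poweR_EFin lee_fin.
  rewrite -[leRHS]powRr1; last by rewrite invr_ge0.
  by apply: ger_powR => //; rewrite invr_gt0 ltr0n/= invf_le1// ler1n.
(* At each point [|h|] is at most twice the larger of [|g1|] and [|g2|]. *)
move=> x _; have [g12|/ltW g21] := leP `|g1 x| `|g2 x|.
  rewrite -[leLHS]add0e leeD//; apply: key; apply: (le_trans (hg x)).
  by rewrite mule_natl mule2n leeD2r.
rewrite -[leLHS]adde0 leeD//; apply: key; apply: (le_trans (hg x)).
by rewrite mule_natl mule2n leeD2l.
Qed.

Lemma wnorm_le (h g : R -> \bar R) :
  measurable_fun setT h -> measurable_fun setT g ->
  (forall x, `|h x| <= `|g x|) -> wnorm p w h <= wnorm p w g.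
Proof.
move=> mh mg hg; rewrite !wnormE; apply: ereal_inf_le_tmp => _ [l [l0 gl] <-].
exists l => //; split => //; apply: le_trans gl; exact: modular_le.
Qed.

(** Some [l0] has modular at most 1; passing from [l0] to [l] multiplies the density by at most
    [max(1, l0/l)^P], the exponent being bounded by [P]. *)
Lemma wnorm_lty_modular (H : R -> \bar R) l : measurable_fun setT H ->
  wnorm p w H < +oo -> (0 < l)%R -> modular H l < +oo.
Proof.
move=> mH; rewrite wnormE => /ereal_inf_lt[_ [l0 [l00 Hl0] <-]] _ l_gt0.
pose M := Num.max 1%R (l0 / l)%R.
have M1 : (1 <= M)%R by rewrite le_max lexx.
apply: (@le_lt_trans _ _ ((M `^ P)%R%:E * modular H l0)); last first.
  apply: (@le_lt_trans _ _ ((M `^ P)%R%:E * 1)); last by rewrite mule1 ltry.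
  by rewrite lee_wpmul2l// lee_fin powR_ge0.
rewrite -ge0_integralZl_EFin ?powR_ge0//; last 2 first.
- by move=> x _; exact: modular_density_ge0.
- exact: measurable_modular_density.
apply: ge0_le_integral => //.
- by move=> x _; exact: modular_density_ge0.
- exact: measurable_modular_density.
- by apply: measurable_funeM; exact: measurable_modular_density.
move=> x _; rewrite /modular_density muleA.
apply: lee_wpmul2r; first by rewrite lee_fin ltW.
apply: (@le_trans _ _ ((M%:E * (`|H x| * (l0^-1)%:E)) `^ p x)).
  apply: poweR_le; first exact: ltW.
    by rewrite mule_ge0// lee_fin invr_ge0 ltW.
  rewrite [leRHS]muleCA -EFinM; apply: lee_wpmul2l => //.
  rewrite lee_fin ler_pdivlMr// mulrC -[(_ * _^-1)%R]/(l0 / l)%R.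
  by rewrite le_max lexx orbT.
rewrite poweRM; last 2 first.
- by rewrite lee_fin (le_trans ler01).
- by rewrite mule_ge0// lee_fin invr_ge0 ltW.
apply: lee_wpmul2r; first exact: poweR_ge0.
by rewrite poweR_EFin lee_fin ler_powR.
Qed.

(** With [l] fixed, the density of [H] is an integrable majorant, so the modulars of [h n] tend to
    0. Being eventually below 1 is all that a norm at most [l] requires. *)
Lemma wnorm_dominated_convergence (h : (R -> \bar R)^nat) (H : R -> \bar R) l :
  (forall n, measurable_fun setT (h n)) -> measurable_fun setT H ->
  (forall n x, `|h n x| <= `|H x|) ->
  {ae mu, forall x, h ^~ x @ \oo --> 0} ->
  wnorm p w H < +oo -> (0 < l)%R ->
  \forall n \near \oo, wnorm p w (h n) <= l%:E.
Proof.
move=> mh mH hH h0 Hoo l0.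
have mdens g : measurable_fun setT g -> measurable_fun setT
    (modular_density g l) by exact: measurable_modular_density.
have := @dominated_convergence _ _ R mu setT measurableT
  (fun n => modular_density (h n) l) (cst 0) (modular_density H l).
case.
- by move=> n; exact: mdens.
- exact: measurable_cst.
- apply: (@filterS _ _ (ae_filter_ringOfSetsType mu) _ _ _ h0) => x hx0 _ /=.
  have hx0' : `|h n x| * (l^-1)%:E @[n --> \oo] --> 0.
    by rewrite -(mul0e (l^-1)%:E); apply: cvgeZr => //; exact/cvg_abse0P.
  (* Once [|h n x| / l < 1], its [p x]-th power is at most itself, so a bound linear in [|h n x|]
     suffices. *)
  apply: (@squeeze_cvge _ _ _ _ (cst 0) _
    (fun n => `|h n x| * (l^-1)%:E * (w x)%:E)).
  + have := cvge0_lt hx0' ltr01; apply: filterS => n hn1.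
    rewrite modular_density_ge0/=; apply: lee_wpmul2r.
      by rewrite lee_fin ltW.
    apply: poweR_le_self => //; last exact: ltW.
    by rewrite mule_ge0// lee_fin invr_ge0 ltW.
  + exact: cvg_cst.
  + by rewrite -(mul0e (w x)%:E); exact: cvgeZr.
- apply/integrableP; split; first exact: mdens.
  rewrite (_ : \int[mu]_x _ = modular H l).
    exact: wnorm_lty_modular.
  by apply: eq_integral => x _; rewrite gee0_abs// modular_density_ge0.
- apply/aeW => x n _; rewrite gee0_abs ?modular_density_ge0//.
  exact: modular_density_le.
move=> _ _; rewrite integral0 => /cvge0_lt /(_ ltr01).
by apply: filterS => n /= hn; apply: wnorm_le_modular => //; exact: ltW.
Qed.

Lemma wnorm0 : wnorm p w (cst 0) = 0.
Proof.
apply/eqP; rewrite eq_le wnorm_ge0 andbT; apply/lee_addgt0Pr => e e0.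
rewrite add0e; apply: wnorm_le_modular => //.
rewrite /modular (_ : modular_density _ _ = cst 0) ?integral0//.
apply/funext => x; rewrite /modular_density /cst abse0 mul0e.
by rewrite poweR0r ?gt_eqF// mul0e.
Qed.

End modular.

(** * The amalgam norm: quasi-triangle inequality and dominated convergence *)

Section amalgam_norm.
Context {R : realType}.
Local Notation mu := (@lebesgue_measure R).
Local Open Scope ereal_scope.
Variables (p w : R -> R) (P q : R).
Hypotheses (mp : measurable_fun [set: R] p) (p1 : forall x, (1 <= p x)%R)
  (pP : forall x, (p x <= P)%R).
Hypotheses (mw : measurable_fun [set: R] w) (w0 : forall x, (0 < w x)%R).
Hypothesis q1 : (1 <= q)%R.

Let q_gt0 : (0 < q)%R. Proof. exact: lt_le_trans q1. Qed.

Let qV0 : (0 <= q^-1)%R. Proof. by rewrite invr_ge0 ltW. Qed.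

Lemma measurable_unit_cell k : measurable (unit_cell k : set R).
Proof. exact: measurable_itv. Qed.

Lemma measurable_restrict_cell (h : R -> \bar R) k :
  measurable_fun setT h -> measurable_fun setT (h \_ (unit_cell k)).
Proof.
move=> mh; apply/(measurable_restrictT _ _).1.
  exact: measurable_unit_cell.
exact: measurable_funTS.
Qed.

Let S (h : R -> \bar R) : \bar R :=
  \esum_(k in [set: int]) (wnorm p w (h \_ (unit_cell k)) `^ q).

Let S_ge0 h : 0 <= S h.
Proof. by apply: esum_ge0 => k _; exact: poweR_ge0. Qed.

Let poweRK x : 0 <= x -> (x `^ q^-1) `^ q = x :> \bar R.
Proof. by move=> x0; rewrite -poweRrM mulVf ?gt_eqF// poweRe1. Qed.

Let poweRVK x : 0 <= x -> (x `^ q) `^ q^-1 = x :> \bar R.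
Proof. by move=> x0; rewrite -poweRrM mulfV ?gt_eqF// poweRe1. Qed.

Lemma amalgam_norm_ge0 h : 0 <= amalgam_norm p q w h.
Proof. exact: poweR_ge0. Qed.

Lemma amalgam_norm_leP h (e : R) : (0 <= e)%R ->
  amalgam_norm p q w h <= e%:E <-> S h <= (e `^ q)%:E.
Proof.
move=> e0; split => he.
- rewrite -(poweRK (S_ge0 h)) -poweR_EFin; apply: poweR_le => //.
    exact: ltW.
  exact: poweR_ge0.
- have -> : e%:E = ((e `^ q)%:E) `^ q^-1 by rewrite -poweR_EFin poweRVK.
  by apply: poweR_le; [exact: qV0|exact: S_ge0|exact: he].
Qed.

Lemma amalgam_norm_lty h : amalgam_norm p q w h < +oo -> S h < +oo.
Proof. by apply: lty_poweRy; rewrite gt_eqF// invr_gt0. Qed.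

Lemma wnorm_cell_le h k :
  wnorm p w (h \_ (unit_cell k)) <= amalgam_norm p q w h.
Proof.
rewrite -[leLHS]poweRVK ?wnorm_ge0//.
apply: poweR_le => //; first exact: poweR_ge0.
by apply: esum_ge; exists [set k]; [split|rewrite fsbig_set1].
Qed.

(** The constant is 8 = 4 * 2: the 4 comes from each cell, and the 2 from [e^q + e^q <= (2 * e)^q],
    valid since [q >= 1]. *)
Lemma amalgam_norm_quasi_triangle (h g1 g2 : R -> \bar R) (e : R) :
  measurable_fun setT h -> measurable_fun setT g1 -> measurable_fun setT g2 ->
  (forall x, `|h x| <= `|g1 x| + `|g2 x|) ->
  amalgam_norm p q w g1 <= e%:E -> amalgam_norm p q w g2 <= e%:E ->
  amalgam_norm p q w h <= (8 * e)%:E.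
Proof.
move=> mh mg1 mg2 hg g1e g2e.
have := le_trans (amalgam_norm_ge0 g1) g1e; rewrite lee_fin => e0.
apply/amalgam_norm_leP; first by rewrite mulr_ge0.
move/(amalgam_norm_leP _ e0) : (g1e) => Sg1.
move/(amalgam_norm_leP _ e0) : (g2e) => Sg2.
have key k : wnorm p w (h \_ (unit_cell k)) `^ q <= (4 `^ q)%R%:E *
    (wnorm p w (g1 \_ (unit_cell k)) `^ q +
     wnorm p w (g2 \_ (unit_cell k)) `^ q).
  (* The cell norms are at most [e], hence real numbers [a] and [b]. The cell inequality is applied
     with [max a b], whose [q]-th power is at most [a^q + b^q]. *)
  have := le_trans (wnorm_cell_le g1 k) g1e.
  have := le_trans (wnorm_cell_le g2 k) g2e.
  have := wnorm_ge0 p w (g2 \_ (unit_cell k)).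
  have := wnorm_ge0 p w (g1 \_ (unit_cell k)).
  case E1 : (wnorm p w (g1 \_ _)) => [a| |]//.
  case E2 : (wnorm p w (g2 \_ _)) => [b| |]//.
  rewrite !lee_fin => a0 b0 _ _.
  have : wnorm p w (h \_ (unit_cell k)) <= (4 * Num.max a b)%:E.
    apply: (@wnorm_quasi_triangle _ _ _ mp p1 mw w0 _
      (g1 \_ (unit_cell k)) (g2 \_ (unit_cell k))).
    - exact: measurable_restrict_cell.
    - exact: measurable_restrict_cell.
    - exact: measurable_restrict_cell.
    - exact: le_abse_restrict.
    - by rewrite E1 lee_fin le_max lexx.
    - by rewrite E2 lee_fin le_max lexx orbT.
  move=> /(poweR_le (ltW q_gt0) (wnorm_ge0 _ _ _)) /le_trans; apply.
  rewrite !poweR_EFin -EFinD -EFinM lee_fin powRM//; last by rewrite le_max a0.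
  rewrite ler_wpM2l ?powR_ge0//.
  by case: (leP a b) => _; rewrite ?lerDl ?lerDr powR_ge0.
apply: (@le_trans _ _ ((4 `^ q)%R%:E * (S g1 + S g2))).
  rewrite -esumD; try by move=> k _; exact: poweR_ge0.
  apply: esum_le_mul; first exact: powR_ge0.
    by move=> k; rewrite adde_ge0// poweR_ge0.
  by move=> k _; exact: key.
apply: (@le_trans _ _ ((4 `^ q)%R%:E * ((e `^ q)%:E + (e `^ q)%:E))).
  apply: lee_wpmul2l; first by rewrite lee_fin powR_ge0.
  by apply: leeD; [exact: Sg1|exact: Sg2].
rewrite -EFinD -EFinM lee_fin (_ : 8 * e = 4 * (2 * e))%R; last by ring.
rewrite powRM ?mulr_ge0// ler_wpM2l ?powR_ge0// powRM//.
rewrite (_ : e `^ q + e `^ q = 2 * e `^ q)%R; last by ring.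
apply: ler_wpM2r; first exact: powR_ge0.
by rewrite -[leLHS]powRr1// ler_powR// ler1n.
Qed.

Lemma amalgam_norm_le (h g : R -> \bar R) :
  measurable_fun setT h -> measurable_fun setT g ->
  (forall x, `|h x| <= `|g x|) ->
  amalgam_norm p q w h <= amalgam_norm p q w g.
Proof.
move=> mh mg hg; apply: poweR_le; [exact: qV0|exact: S_ge0|].
apply: le_esum => k _; apply: poweR_le; [exact: ltW|exact: wnorm_ge0|].
apply: (wnorm_le mp p1 mw w0); [exact: measurable_restrict_cell..|].
by move=> x; rewrite /patch; case: ifP.
Qed.

(** Outside a finite set [A] of cells the sum for [H] is at most [e^q / 2]. On [A], convergence in
    each of the finitely many cells gives the other half. *)
Lemma amalgam_norm_dominated_convergence (h : (R -> \bar R)^nat)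
    (H : R -> \bar R) (e : R) :
  (forall n, measurable_fun setT (h n)) -> measurable_fun setT H ->
  (forall n x, `|h n x| <= `|H x|) ->
  {ae mu, forall x, h ^~ x @ \oo --> 0} ->
  amalgam_norm p q w H < +oo -> (0 < e)%R ->
  \forall n \near \oo, amalgam_norm p q w (h n) <= e%:E.
Proof.
move=> mh mH hH h0 Hoo e0.
have d0 : (0 < e `^ q / 2)%R by rewrite divr_gt0// powR_gt0.
have [A finA HA] := @esum_tail _ _
  (fun k => wnorm p w (H \_ (unit_cell k)) `^ q) _
  (fun k => poweR_ge0 _ _) (amalgam_norm_lty Hoo) d0.
pose N := #|` fset_set A|%fset.
(* Chosen so that [N] terms [l^q] add up to at most [e^q / 2]; the successor keeps the denominator
   nonzero when [A] is empty. *)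
pose l := ((e `^ q / 2 / N.+1%:R) `^ q^-1)%R.
have l0 : (0 < l)%R by rewrite powR_gt0// divr_gt0.
have hHk n k x : `|(h n \_ (unit_cell k)) x| <= `|(H \_ (unit_cell k)) x|.
  by rewrite /patch; case: ifP.
have hnear : \forall n \near \oo, forall k, A k ->
    wnorm p w (h n \_ (unit_cell k)) <= l%:E.
  apply: near_finite_set => // k _.
  apply: (wnorm_dominated_convergence mp p1 pP mw w0
    (h := fun n => h n \_ (unit_cell k)) (H := H \_ (unit_cell k))) => //.
  - by move=> n; exact: measurable_restrict_cell.
  - exact: measurable_restrict_cell.
  - apply: (@filterS _ _ (ae_filter_ringOfSetsType mu) _ _ _ h0) => x hx.
    by rewrite /patch; case: (x \in unit_cell k) => //; exact: cvg_cst.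
  - exact: le_lt_trans (wnorm_cell_le H k) Hoo.
apply: filterS hnear => n hn; apply/amalgam_norm_leP; first exact: ltW.
rewrite /S (esumID A); last by move=> k _; exact: poweR_ge0.
rewrite !setTI esum_fset//; last by move=> k _; exact: poweR_ge0.
have -> : (e `^ q = e `^ q / 2 + e `^ q / 2)%R by field.
rewrite EFinD; apply: leeD; last first.
  apply: le_trans HA; apply: le_esum => k _.
  apply: poweR_le; [exact: ltW|exact: wnorm_ge0|].
  by apply: (wnorm_le mp p1 mw w0) => //; exact: measurable_restrict_cell.
apply: (@le_trans _ _ ((l `^ q) *+ N)%:E).
  apply: fsum_le_cst => // k Ak; rewrite -poweR_EFin.
  by apply: poweR_le; [exact: ltW|exact: wnorm_ge0|exact: hn].
rewrite lee_fin /l -powRrM mulVf ?gt_eqF// powRr1; last first.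
  by rewrite ltW// divr_gt0.
rewrite -mulr_natr -mulrA ler_piMr//; first exact: ltW.
by rewrite mulrC ler_pdivrMr// mul1r ler_nat.
Qed.

End amalgam_norm.

(** * Pointwise bounds on the exponent, and a splitting inequality of Young type *)

Section exponent.
Context {R : realType}.
Local Notation mu := (@lebesgue_measure R).

(** Since [ln (e + |x|) >= 1], the decay condition at infinity keeps [p] within [C] of its limit. *)
Lemma log_holder_bounded (p : R -> R) : log_holder p ->
  exists P, forall x, p x <= P.
Proof.
move=> [C [pinf [C0 _ _ H]]]; exists (pinf + C) => x.
have h1 : 1 <= ln (expR 1 + `|x|).
  have x0 : 0 < expR 1 + `|x| by rewrite ltr_wpDr ?expR_gt0.
  by rewrite -[leLHS]expRK ler_ln ?posrE ?expR_gt0// lerDl.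
have h2 : C / ln (expR 1 + `|x|) <= C.
  by rewrite ler_pdivrMr ?(lt_le_trans ltr01)// ler_peMr// ltW.
rewrite -lerBlDl; apply: le_trans (ler_norm _) _.
exact: le_trans (H x) h2.
Qed.

Lemma log_holder_near (p : R -> R) x (e : R) : log_holder p -> 0 < e ->
  exists2 d, 0 < d & forall y, `|x - y| < d -> `|p x - p y| < e.
Proof.
move=> [C [_ [C0 _ H _]]] e0.
(* For [|x - y|] below this radius, [1 / |x - y|] exceeds [exp (C / e)], so the logarithm exceeds
   [C / e]. *)
exists (expR (C / e))^-1; first by rewrite invr_gt0 expR_gt0.
move=> y xy; have [->|xNy] := eqVneq x y; first by rewrite subrr normr0.
have nxy : 0 < `|x - y| by rewrite normr_gt0 subr_eq0.
have h1 : C / e < ln (expR 1 + 1 / `|x - y|).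
  have xy0 : 0 < expR 1 + 1 / `|x - y| by rewrite addr_gt0 ?expR_gt0// divr_gt0.
  rewrite -[ltLHS]expRK ltr_ln ?posrE ?expR_gt0//
    ltr_wpDl ?expR_ge0// div1r -[ltLHS]invrK ltf_pV2 ?posrE//.
  by rewrite invr_gt0 expR_gt0.
apply: le_lt_trans (H x y) _.
rewrite ltr_pdivrMr; first by rewrite -ltr_pdivrMl// mulrC.
by apply: le_lt_trans h1; rewrite divr_ge0// ltW.
Qed.

Lemma lebesgue_measure_ball_gt0 (x r : R) : 0 < r -> (0 < mu (ball x r))%E.
Proof.
by move=> r0; rewrite lebesgue_measure_ball ?ltW// lte_fin pmulrn_lgt0.
Qed.

Lemma ball_not_negligible (x r : R) (Q : R -> Prop) : 0 < r ->
  {ae mu, forall y, Q y} -> exists2 y, ball x r y & Q y.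
Proof.
move=> r0 [N [mN N0 QN]]; apply: contrapT => nQ.
have bN : ball x r `<=` N.
  by move=> y xy; apply: QN => /= Qy; apply: nQ; exists y.
have := lebesgue_measure_ball_gt0 x r0; apply/negP; rewrite -leNgt -N0.
by rewrite le_measure//; apply: mem_set => //; exact: measurable_ball.
Qed.

(** The essential infimum gives the bound almost everywhere. Were it to fail at [x], by continuity
    it would fail on a whole ball, which is not negligible. *)
Lemma exponent_inf_gt1 (p : R -> R) : log_holder p ->
  (1 < exponent_inf p)%E -> exists2 c, 1 < c & forall x, c <= p x.
Proof.
move=> hp p1.
have [c c1 cp] : exists2 c : R, 1 < c & (c%:E <= exponent_inf p)%E.
  move: p1; case: exponent_inf => [r| |]//; first by rewrite lte_fin; exists r.
  by move=> _; exists 2; rewrite ?leey// ltr1n.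
have {}cp : {ae mu, forall x, (c%:E <= (p x)%:E)%E} by exact/ess_infP.
exists c => // x; rewrite leNgt; apply/negP => pxc.
have cpx : 0 < c - p x by rewrite subr_gt0.
have [d d0 hd] := log_holder_near x hp cpx.
have [y xy] := ball_not_negligible x d0 cp.
rewrite lee_fin => cpy; have := hd y xy; rewrite distrC => h.
have := le_lt_trans (ler_norm _) h; lra.
Qed.

(** The exponent [(1 - s^-1)^-1 / s] is [1/(s-1)], written as in the A_p condition. If
    [eta * t^(s-1) * w >= 1] the first term already exceeds [t]; otherwise solving for [t] gives the
    second one. *)
Lemma powR_split_le (c s w t eta : R) : 0 <= t -> 0 < w -> 1 < c -> c <= s ->
  0 < eta -> eta <= 1 ->
  t <= eta * (t `^ s * w) +
       eta `^ (- (c - 1)^-1) * w^-1 `^ ((1 - s^-1)^-1 / s).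
Proof.
move=> t0 w0 c1 cs e0 e1.
have s1 : 1 < s by exact: lt_le_trans cs.
have s0 : 0 < s by exact: lt_trans s1.
have sB0 : 0 < s - 1 by rewrite subr_gt0.
have cB0 : 0 < c - 1 by rewrite subr_gt0.
have -> : (1 - s^-1)^-1 / s = (s - 1)^-1.
  by field; rewrite !gt_eqF.
have [t_eq0|tN0] := eqVneq t 0.
  by rewrite {1}t_eq0 addr_ge0// ?mulr_ge0 ?powR_ge0// ltW.
have t_gt0 : 0 < t by rewrite lt0r tN0.
have [h|h] := leP 1 (eta * (t `^ (s - 1) * w)).
  rewrite -[leLHS]addr0 lerD ?mulr_ge0 ?powR_ge0//.
  have -> : eta * (t `^ s * w) = t * (eta * (t `^ (s - 1) * w)).
    have -> : t `^ s = t * t `^ (s - 1).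
      rewrite -{2}(powRr1 t0) -powRD ?tN0 ?implybT//.
      by congr (_ `^ _); ring.
    by ring.
  by rewrite ler_peMr.
rewrite -[leLHS]add0r lerD ?mulr_ge0 ?powR_ge0 ?(ltW e0) ?(ltW w0)//.
have h1 : t `^ (s - 1) <= eta^-1 * w^-1.
  by rewrite -invfM -[leRHS]mul1r ler_pdivlMr ?mulr_gt0//; nra.
have h2 : t <= (eta^-1 * w^-1) `^ (s - 1)^-1.
  have -> : t = (t `^ (s - 1)) `^ (s - 1)^-1.
    by rewrite -powRrM mulfV ?gt_eqF// powRr1.
  by rewrite ge0_ler_powR ?nnegrE ?powR_ge0 ?mulr_ge0 ?invr_ge0 ?(ltW e0)
    ?(ltW w0) ?(ltW sB0).
apply: (le_trans h2); rewrite powRM ?invr_ge0 ?(ltW e0) ?(ltW w0)//.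
apply: ler_wpM2r; first exact: powR_ge0.
rewrite powRN -powR_inv1 ?(ltW e0)// -powRrM mulN1r powRN.
rewrite lef_pV2 ?posrE ?powR_gt0//.
(* As [eta <= 1], the factor [eta^(-1/(s-1))] is largest at [s = c]; this makes the coefficient
   independent of the point. *)
by apply: ger_powR; [rewrite e0|rewrite lef_pV2 ?posrE// lerD2r].
Qed.

End exponent.

(** * Local integrability of the dual weight *)

Section dual_weight.
Context {R : realType}.
Local Notation mu := (@lebesgue_measure R).
Local Open Scope ereal_scope.
Variables (p w : R -> R) (c : R).
Hypotheses (mp : measurable_fun [set: R] p) (c1 : (1 < c)%R)
  (cp : forall x, (c <= p x)%R).
Hypotheses (mw : measurable_fun [set: R] w) (w0 : forall x, (0 < w x)%R).

Let p_gt1 x : (1 < p x)%R. Proof. exact: lt_le_trans (cp x). Qed.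

Let p_gt0 x : (0 < p x)%R. Proof. exact: lt_trans (p_gt1 x). Qed.

Definition dual_exponent x : R := (conjugate_exponent p x / p x)%R.

(** This is sigma = [w^(-1/(p-1))]. *)
Definition dual_weight x : R := ((w x)^-1 `^ dual_exponent x)%R.

Lemma dual_exponentE x : dual_exponent x = ((p x - 1)^-1)%R.
Proof.
have p1 : (0 < p x - 1)%R by rewrite subr_gt0.
by rewrite /dual_exponent /conjugate_exponent; field; rewrite !gt_eqF.
Qed.

Lemma dual_exponent_gt0 x : (0 < dual_exponent x)%R.
Proof. by rewrite dual_exponentE invr_gt0 subr_gt0. Qed.

Lemma dual_exponent_le x : (dual_exponent x <= (c - 1)^-1)%R.
Proof. by rewrite dual_exponentE lef_pV2 ?posrE ?subr_gt0// lerD2r. Qed.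

Lemma measurable_dual_exponent : measurable_fun [set: R] dual_exponent.
Proof.
rewrite (_ : dual_exponent = fun x => (p x - 1)^-1)%R; last first.
  by apply/funext => x; exact: dual_exponentE.
apply: measurable_inv; last exact: measurable_funB.
by move=> x; rewrite subr_gt0.
Qed.

Lemma dual_weight_ge0 x : (0 <= dual_weight x)%R. Proof. exact: powR_ge0. Qed.

Lemma measurable_dual_weight : measurable_fun [set: R] dual_weight.
Proof.
apply: measurable_powR_variable; last exact: measurable_dual_exponent.
exact: measurable_inv.
Qed.

(** A zero integral would make the positive function [w] vanish almost everywhere on a ball of
    positive measure. *)
Lemma integral_weight_gt0 (x r : R) : (0 < r)%R ->
  0 < \int[mu]_(y in ball x r) `|w y|%:E.
Proof.
move=> r0; rewrite lt0e integral_ge0 ?andbT//.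
apply/negP => /eqP wint0.
have mE : measurable_fun (ball x r) (EFin \o w).
  exact/measurable_EFinP/measurable_funTS.
have [/(_ wint0) H _] :=
  @ae_eq_integral_abs _ _ _ mu _ (measurable_ball x r) _ mE.
have [y xy] := ball_not_negligible x r0 H.
by move=> /(_ xy)/= -[] wy; have := w0 y; rewrite wy ltxx.
Qed.

(** The other two factors of the A_p quantity are positive, so an infinite third factor would make
    the product infinite. *)
Lemma luxemburg_dual_lty (x r : R) : (0 < r)%R -> Apx p w ->
  luxemburg (ball x r) dual_exponent (fun x => ((w x)^-1)%:E) < +oo.
Proof.
move=> r0 wA; have : Apx_quantity p w (ball x r) < +oo.
  apply: le_lt_trans wA; apply: ereal_sup_ubound.
  by exists (ball x r) => //; exists x, r.
rewrite /Apx_quantity; apply: contraTT; rewrite -!leNgt !leye_eq => /eqP ->.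
rewrite gt0_muley//; apply: mule_gt0; last exact: integral_weight_gt0.
by rewrite lte_fin powR_gt0// lebesgue_measure_ball ?ltW//= pmulrn_lgt0.
Qed.

(** Finiteness of the Luxemburg expression provides a scale [l] at which the modular of [1/w] is at
    most 1. Undoing the scaling costs at most [M^(1/(c-1))], since [M >= 1] and the dual exponent is
    at most [1/(c-1)]. *)
Lemma integral_dual_weight_lty (x r : R) : (0 < r)%R -> Apx p w ->
  \int[mu]_(y in ball x r) (dual_weight y)%:E < +oo.
Proof.
move=> r0 /(luxemburg_dual_lty x r0) /ereal_inf_lt[_ [l [l0 hl] <-] _].
pose M := Num.max 1%R l; have M1 : (1 <= M)%R by rewrite le_max lexx.
pose D y := (`|((w y)^-1)%:E| * (l^-1)%:E) `^ dual_exponent y.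
have mD : measurable_fun (ball x r) D.
  apply: measurable_funTS; apply: measurable_poweR_variable.
  - by move=> y; rewrite mule_ge0// lee_fin invr_ge0 ltW.
  - exact: dual_exponent_gt0.
  - apply: emeasurable_funM => //; apply: measurableT_comp => //.
    apply/measurable_EFinP; exact: measurable_inv.
  - exact: measurable_dual_exponent.
apply: (@le_lt_trans _ _ ((M `^ (c - 1)^-1)%R%:E *
    \int[mu]_(y in ball x r) D y)).
  rewrite -ge0_integralZl_EFin ?powR_ge0//; last 2 first.
  - exact: measurable_ball.
  - by move=> y _; exact: poweR_ge0.
  apply: ge0_le_integral.
  - exact: measurable_ball.
  - by move=> y _; rewrite lee_fin dual_weight_ge0.
  - apply/measurable_EFinP; apply: measurable_funTS.
    exact: measurable_dual_weight.
  - exact: measurable_funeM.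
  move=> y _; have wV : (0 <= (w y)^-1)%R by rewrite invr_ge0 ltW.
  have -> : D y = (((w y)^-1 / l) `^ dual_exponent y)%:E.
    by rewrite /D /= ger0_norm.
  rewrite -EFinM lee_fin.
  have -> : dual_weight y =
      (l `^ dual_exponent y * ((w y)^-1 / l) `^ dual_exponent y)%R.
    rewrite -powRM ?divr_ge0 ?(ltW l0)// mulrCA divff ?mulr1//.
    by rewrite gt_eqF.
  apply: ler_wpM2r; first exact: powR_ge0.
  apply: (@le_trans _ _ (M `^ dual_exponent y)%R).
    apply: ge0_ler_powR; rewrite ?nnegrE ?(ltW l0) ?le_max ?lexx ?orbT//.
    + exact/ltW/dual_exponent_gt0.
    + by rewrite ler01.
  by rewrite ler_powR// dual_exponent_le.
apply: (@le_lt_trans _ _ ((M `^ (c - 1)^-1)%R%:E * 1)).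
  by apply: lee_wpmul2l => //; rewrite lee_fin powR_ge0.
by rewrite mule1 ltry.
Qed.

End dual_weight.

(** * Local L^1 bounds and equi-integrability from bounds on the cell norms *)

Section local_integrability.
Context {R : realType}.
Local Notation mu := (@lebesgue_measure R).
Local Open Scope ereal_scope.

(** Half-open, so as to be exactly a union of [2 * m] unit cells. *)
Definition box m : set R := `[(- m%:R)%R, m%:R%R[%classic.

Lemma measurable_box m : measurable (box m). Proof. exact: measurable_itv. Qed.

Lemma box_sub_ball m : box m `<=` ball 0%R (m.+1%:R : R).
Proof.
move=> x; rewrite /box /ball/= in_itv/= sub0r normrN ltr_norml -natr1.
by move=> /andP[? ?]; apply/andP; split; lra.
Qed.

Lemma integral_itv_le_cells (u : R -> \bar R) (a : int) n :
  measurable_fun [set: R] u -> (forall x, 0 <= u x) ->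
  (forall k, \int[mu]_(x in unit_cell k) u x <= 1) ->
  \int[mu]_(x in `[a%:~R%R, (a + n%:Z)%:~R%R[) u x <= n%:R%:E.
Proof.
move=> mfu u0 ucell; elim: n => [|n IH].
  by rewrite addr0 set_itvco0 integral_set0.
have -> : `[a%:~R%R, (a + n.+1%:Z)%:~R%R[%classic =
    `[a%:~R%R, (a + n%:Z)%:~R%R[ `|` unit_cell (a + n%:Z) :> set R.
  rewrite /unit_cell -(@itv_bndbnd_setU _ _ _ (BLeft (a + n%:Z)%:~R%R)).
  - by rewrite -addrA intS [(1 + _)%R]addrC.
  - by rewrite bnd_simp ler_int lerDl.
  - by rewrite bnd_simp ler_int lerDl.
rewrite ge0_integral_setU//; last 3 first.
- exact: measurable_unit_cell.
- exact: measurable_funTS.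
- apply/disj_setPS => x [] /=; rewrite !in_itv/= => /andP[_ h1] /andP[h2 _].
  by move: (lt_le_trans h1 h2); rewrite ltxx.
by rewrite -natr1 EFinD; apply: leeD.
Qed.

Lemma integral_box_le_cells (u : R -> \bar R) m :
  measurable_fun [set: R] u -> (forall x, 0 <= u x) ->
  (forall k, \int[mu]_(x in unit_cell k) u x <= 1) ->
  \int[mu]_(x in box m) u x <= (m + m)%:R%:E.
Proof.
move=> mfu u0 ucell;
have := integral_itv_le_cells (- m%:Z) (m + m) mfu u0 ucell.
by rewrite PoszD addKr mulrNz.
Qed.

Variables (p w : R -> R) (c : R).
Hypotheses (mp : measurable_fun [set: R] p) (c1 : (1 < c)%R)
  (cp : forall x, (c <= p x)%R).
Hypotheses (mw : measurable_fun [set: R] w) (w0 : forall x, (0 < w x)%R).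
Hypothesis wA : Apx p w.

Let p1 x : (1 <= p x)%R. Proof. exact: le_trans (ltW c1) (cp x). Qed.

Let p_gt0 x : (0 < p x)%R. Proof. exact: lt_le_trans (p1 x). Qed.

(** The consequence of a norm bound that the local estimates use. The inequality is strict so that
    the modular at scale [K] is at most 1 on each cell. *)
Definition cells_bounded (K : R) (f : R -> R) := measurable_fun [set: R] f /\
  forall k, wnorm p w ((EFin \o f) \_ (unit_cell k)) < K%:E.

Lemma cells_bounded_gt0 K f : cells_bounded K f -> (0 < K)%R.
Proof.
by move=> [_ /(_ 0%R)]; rewrite -lte_fin; apply: le_lt_trans; exact: wnorm_ge0.
Qed.

Lemma cells_bounded_modular K f k : cells_bounded K f ->
  \int[mu]_(x in unit_cell k) modular_density p w (EFin \o f) K x <= 1.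
Proof.
move=> [mf fK].
have mfk : measurable_fun [set: R] ((EFin \o f) \_ (unit_cell k)).
  by apply: measurable_restrict_cell; exact/measurable_EFinP.
have [K0] := wnorm_lt_modular mp p1 mw w0 mfk (fK k).
apply: le_trans; rewrite le_eqVlt; apply/orP; left; apply/eqP.
by rewrite integral_mkcond /modular modular_density_restrict.
Qed.

(** The splitting inequality is integrated with [t = |f| / K]. The modular part contributes at most
    1 per cell of the box, whatever [E] is, so only the dual weight sees the size of [E]. *)
Lemma integral_le_dual_weight K f m eta (E : set R) : cells_bounded K f ->
  (0 < eta)%R -> (eta <= 1)%R -> measurable E -> E `<=` box m ->
  \int[mu]_(x in E) `|f x|%:E <= (K * eta * (m + m)%:R)%:E +
    (K * eta `^ (- (c - 1)^-1))%:E * \int[mu]_(x in E) (dual_weight p w x)%:E.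
Proof.
move=> fK eta0 eta1 mE Em; have K0 := cells_bounded_gt0 fK.
have mf : measurable_fun [set: R] f by case: fK.
pose u := modular_density p w (EFin \o f) K.
have mfu : measurable_fun [set: R] u.
  by apply: measurable_modular_density => //; exact/measurable_EFinP.
have u0 x : 0 <= u x by exact: modular_density_ge0.
have ms : measurable_fun [set: R] (fun x => (dual_weight p w x)%:E).
  by apply/measurable_EFinP; exact: (measurable_dual_weight mp c1 cp mw w0).
pose C := (K * eta `^ (- (c - 1)^-1))%R.
have C0 : (0 <= C)%R by rewrite mulr_ge0 ?powR_ge0// ltW.
have Ke0 : (0 <= K * eta)%R by rewrite mulr_ge0// ltW.
apply: (@le_trans _ _ (\int[mu]_(x in E)
    ((K * eta)%:E * u x + C%:E * (dual_weight p w x)%:E))).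
  apply: ge0_le_integral => //.
  - exact/measurable_funTS/measurable_EFinP/measurableT_comp.
  - apply: measurable_funTS; apply: emeasurable_funD; exact: measurable_funeM.
  move=> x _; rewrite /u /modular_density /= -!EFinM -EFinD lee_fin.
  have := @powR_split_le R c (p x) (w x) (`|f x| / K) eta _ (w0 x) c1 (cp x)
    eta0 eta1.
  rewrite divr_ge0 ?(ltW K0)// => /(_ isT).
  move=> /(ler_wpM2l (ltW K0)); rewrite mulrCA divff ?gt_eqF// mulr1.
  move=> /le_trans; apply.
  by rewrite mulrDr !mulrA.
rewrite ge0_integralD//; last 4 first.
- by move=> x _; rewrite mule_ge0// lee_fin.
- by apply: measurable_funTS; exact: measurable_funeM.
- by move=> x _; rewrite mule_ge0// lee_fin// dual_weight_ge0.
- by apply: measurable_funTS; exact: measurable_funeM.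
rewrite !ge0_integralZl_EFin//; last 3 first.
- by move=> x _; rewrite lee_fin dual_weight_ge0.
- exact: measurable_funTS.
- exact: measurable_funTS.
apply: leeD => //; rewrite [leRHS]EFinM; apply: lee_wpmul2l.
  by rewrite lee_fin.
apply: le_trans (integral_box_le_cells m mfu u0 _).
  apply: ge0_subset_integral => //; first exact: measurable_box.
  exact: measurable_funTS.
by move=> k; exact: cells_bounded_modular.
Qed.

Lemma integral_dual_weight_sub_lty m (E : set R) :
  measurable E -> E `<=` box m ->
  \int[mu]_(x in E) (dual_weight p w x)%:E < +oo.
Proof.
move=> mE Em.
apply: le_lt_trans
  (integral_dual_weight_lty mp c1 cp mw w0 0%R (ltr0Sn R m) wA).
apply: ge0_subset_integral => //.
- exact: measurable_ball.
- apply/measurable_EFinP; apply: measurable_funTS.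
  exact: (measurable_dual_weight mp c1 cp mw w0).
- by move=> x _; rewrite lee_fin dual_weight_ge0.
- exact: subset_trans Em (@box_sub_ball m).
Qed.

(** The cut-off to the box gives an integrable function on the whole line, to which absolute
    continuity of the integral is applied. *)
Lemma integrable_dual_weight m :
  mu.-integrable [set: R] (EFin \o (dual_weight p w \_ (box m))).
Proof.
have ms := measurable_dual_weight mp c1 cp mw w0.
apply/integrableP; split.
  apply/measurable_EFinP; apply/(measurable_restrictT _ _).1.
    exact: measurable_box.
  exact: measurable_funTS.
apply: le_lt_trans
  (integral_dual_weight_sub_lty (measurable_box m) (@subset_refl _ _)).
rewrite [leRHS]integral_mkcond le_eqVlt; apply/orP; left; apply/eqP.
apply: eq_integral => x _ /=; rewrite /patch; case: ifP => _.
  by rewrite ger0_norm// dual_weight_ge0.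
by rewrite normr0.
Qed.

Lemma integral_dual_weight_box m (E : set R) : measurable E -> E `<=` box m ->
  \int[mu]_(x in E) (dual_weight p w x)%:E =
  \int[mu]_(x in E) `|((dual_weight p w \_ (box m)) x)%:E|.
Proof.
move=> mE Em; apply: eq_integral => x /set_mem /Em xm.
by rewrite /patch mem_set//= ger0_norm// dual_weight_ge0.
Qed.

Lemma cells_bounded_L1 K m : exists2 L : R, (0 < L)%R &
  forall f, cells_bounded K f -> \int[mu]_(x in box m) `|f x|%:E <= L%:E.
Proof.
(* For [K <= 0] no function satisfies [cells_bounded], and any [L] will do. *)
have [K0|K0] := ltP 0%R K; last first.
  by exists 1%R => // f /cells_bounded_gt0; rewrite ltNge K0.
set I := \int[mu]_(x in box m) (dual_weight p w x)%:E.
have Ifin : I \is a fin_num.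
  rewrite ge0_fin_numE; last first.
    by apply: integral_ge0 => x _; rewrite lee_fin dual_weight_ge0.
  exact: (integral_dual_weight_sub_lty (measurable_box m) (@subset_refl _ _)).
have I0 : (0 <= fine I)%R.
  by apply/fine_ge0/integral_ge0 => x _; rewrite lee_fin dual_weight_ge0.
exists (K * (m + m)%:R + K * fine I + 1)%R.
  by rewrite ltr_wpDl// addr_ge0 ?mulr_ge0// ltW.
move=> f fK.
(* The splitting with [eta = 1] and [E] the whole box. *)
apply: le_trans (integral_le_dual_weight fK ltr01 (lexx _) (measurable_box m)
  (@subset_refl _ (box m))) _.
by rewrite powR1 !mulr1 -/I -(fineK Ifin) -EFinM -EFinD lee_fin lerDl.
Qed.

(** First [eta] is taken small, making the modular part at most [e / 2] uniformly in [f]; then [d]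
    comes from absolute continuity of the integral of the dual weight. *)
Lemma cells_bounded_equiintegrable K m (e : R) : (0 < e)%R ->
  exists2 d : R, (0 < d)%R & forall f E, cells_bounded K f ->
    measurable E -> E `<=` box m -> mu E < d%:E ->
    \int[mu]_(x in E) `|f x|%:E <= e%:E.
Proof.
move=> e0; have [K0|K0] := ltP 0%R K; last first.
  by exists 1%R => // f E /cells_bounded_gt0; rewrite ltNge K0.
have e20 : (0 < e / 2)%R by rewrite divr_gt0.
(* The added 1 keeps [A] positive when [m = 0]. *)
pose A := (K * (m + m)%:R + 1)%R.
have A0 : (0 < A)%R by rewrite ltr_wpDl// mulr_ge0// ltW.
pose eta := Num.min 1%R (e / 2 / A)%R.
have eta0 : (0 < eta)%R by rewrite lt_min ltr01 divr_gt0.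
have eta1 : (eta <= 1)%R by rewrite ge_min lexx.
pose C := (K * eta `^ (- (c - 1)^-1))%R.
have C0 : (0 < C)%R by rewrite mulr_gt0 ?powR_gt0.
have [d [d0 hd]] := integral_normr_continuous (integrable_dual_weight m)
  (divr_gt0 e20 C0).
exists d => // f E fK mE Em Ed.
apply: (le_trans (integral_le_dual_weight fK eta0 eta1 mE Em)).
have -> : e = (e / 2 + e / 2)%R by field.
rewrite EFinD; apply: leeD.
  rewrite lee_fin mulrAC; apply: (@le_trans _ _ (A * eta)%R).
    by apply: ler_wpM2r; [exact: ltW|rewrite lerDl].
  by rewrite mulrC -ler_pdivlMr// ge_min lexx orbT.
have := hd _ mE Ed; rewrite /Rintegral -integral_dual_weight_box// => hI.
have Ifin : \int[mu]_(x in E) (dual_weight p w x)%:E \is a fin_num.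
  rewrite ge0_fin_numE; last first.
    by apply: integral_ge0 => x _; rewrite lee_fin dual_weight_ge0.
  exact: (integral_dual_weight_sub_lty mE Em).
rewrite -(fineK Ifin) -EFinM lee_fin -/C mulrC -ler_pdivlMr//.
exact: ltW.
Qed.

Lemma cells_bounded_locally_integrable K f : cells_bounded K f ->
  locally_integrable [set: R] f.
Proof.
move=> fK; have mf : measurable_fun [set: R] f by case: fK.
split; [exact: mf|exact: openT|] => A _ cA.
have [M [Mreal AM]] := compact_bounded cA.
have Mb : (0 <= `|M| + 1)%R by rewrite addr_ge0.
pose m := Num.bound (`|M| + 1)%R.
have [L _ /(_ f fK) fL] := cells_bounded_L1 K m.
apply: le_lt_trans (ltry L); apply: le_trans fL.
apply: ge0_subset_integral => //.
- exact: compact_measurable.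
- exact: measurable_box.
- exact/measurable_funTS/measurable_EFinP/measurableT_comp.
move=> x Ax; rewrite /box/= in_itv/=.
have xM : (`|x| <= `|M| + 1)%R.
  apply: (AM (`|M| + 1)%R) => //.
  by rewrite (le_lt_trans (ler_norm _))// ltrDl.
have := le_lt_trans xM (archi_boundP Mb).
by rewrite ltr_norml => /andP[/ltW -> ->].
Qed.

End local_integrability.

(** * Averages over balls *)

Section average.
Context {R : realType}.
Local Notation mu := (@lebesgue_measure R).
Implicit Types (f g : R -> R) (x y r : R).

Lemma locally_integrable_ball f x r : locally_integrable [set: R] f ->
  mu.-integrable (ball x r) (EFin \o f).
Proof.
move=> [mf _ locf]; apply/integrableP; split.
  by apply: measurable_funTS; exact/measurable_EFinP.
have [r0|r0] := leP r 0; first by rewrite (ball0 _ _).2// integral_set0.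
apply: le_lt_trans (locf (closed_ball x r) _ (closed_ballR_compact _)) => //.
apply: ge0_subset_integral => //.
- exact: measurable_ball.
- by apply: measurable_closed_ball; exact: ltW.
- exact/measurable_funTS/measurable_EFinP/measurableT_comp.
- exact: subset_closed_ball.
Qed.

Lemma averageE f x r : 0 < r ->
  average f x r = (r *+ 2)^-1 * \int[mu]_(t in ball x r) f t.
Proof. by move=> r0; rewrite /average lebesgue_measure_ball ?ltW. Qed.

Lemma average_le0 f x r : r <= 0 -> average f x r = 0.
Proof. by move=> r0; rewrite /average (ball0 _ _).2// Rintegral_set0 mulr0. Qed.

Lemma averageB f g x r :
  locally_integrable [set: R] f -> locally_integrable [set: R] g ->
  average (fun t => f t - g t) x r = average f x r - average g x r.
Proof.
move=> lf lg; rewrite /average RintegralB ?mulrBr//.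
- exact: measurable_ball.
- exact: locally_integrable_ball.
- exact: locally_integrable_ball.
Qed.

Lemma locally_integrable_cst k : locally_integrable [set: R] (fun=> k).
Proof.
split; [exact: measurable_cst|exact: openT|move=> K _ cK].
rewrite integral_cst//=; last exact: compact_measurable.
by rewrite lte_mul_pinfty//; exact: compact_finite_measure.
Qed.

Lemma average_cst k x r : 0 < r -> average (fun=> k) x r = k.
Proof.
move=> r0; rewrite averageE// Rintegral_cst; last exact: measurable_ball.
rewrite [fine _](_ : _ = r *+ 2); last first.
  exact: (congr1 fine (lebesgue_measure_ball x (ltW r0))).
by rewrite mulrCA mulVf ?mulr1// mulrn_eq0/= gt_eqF.
Qed.

Lemma normr_average_le f x r : locally_integrable [set: R] f -> 0 < r ->
  (`|average f x r|%:E <= iavg f (ball x r))%E.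
Proof.
move=> lf r0; rewrite averageE// normrM /iavg lebesgue_measure_ball ?(ltW r0)//.
rewrite EFinM inver mulrn_eq0/= gt_eqF//=.
rewrite ger0_norm ?invr_ge0 ?mulrn_wge0 ?(ltW r0)//.
apply: lee_wpmul2l; first by rewrite lee_fin invr_ge0 mulrn_wge0// ltW.
have intf := @locally_integrable_ball _ x r lf.
rewrite EFin_normr_Rintegral//; last exact: measurable_ball.
apply: le_abse_integral; first exact: measurable_ball.
by case/integrableP : intf.
Qed.

Lemma normr_average_le_maximal f x r : locally_integrable [set: R] f -> 0 < r ->
  (`|average f x r|%:E <= HL_maximal f x)%E.
Proof.
move=> lf r0; apply: le_trans (normr_average_le x lf r0) _.
by apply: ereal_sup_ubound; exists r => //=; rewrite in_itv/= r0.
Qed.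

(** Up to sign, [f x - average f x r] is the average of [f - f x], which the mean deviation [davg]
    dominates; the latter tends to 0 at a Lebesgue point. *)
Lemma cvg_average f x (r : R^nat) : locally_integrable [set: R] f ->
  lebesgue_pt f x -> (forall n, 0 < r n) -> r @ \oo --> 0 ->
  ((f x - average f x (r n))%:E @[n --> \oo] --> 0)%E.
Proof.
move=> lf fx r0 rcvg; apply/cvg_abse0P.
move/cvge_at_rightP : fx => /(_ r) /(_ (conj r0 rcvg)) fx.
apply: (@squeeze_cvge _ _ _ _ (cst 0%E) _
  (fun n => davg f x (r n))) => //; last first.
  exact: cvg_cst.
apply: nearW => n /=; rewrite lee_fin normr_ge0/=.
have lfx : locally_integrable [set: R] (fun t => f t - f x).
  by apply: locally_integrableB => //; exact: locally_integrable_cst.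
apply: le_trans (normr_average_le x lfx (r0 n)).
rewrite averageB//; last exact: locally_integrable_cst.
by rewrite average_cst// distrC.
Qed.

(** The integrals over the common part [A] meet [B] cancel, leaving the symmetric difference. *)
Lemma Rintegral_subset_bound f (A B : set R) : measurable A -> measurable B ->
  mu.-integrable A (EFin \o f) -> mu.-integrable B (EFin \o f) ->
  (`|\int[mu]_(t in A) f t - \int[mu]_(t in B) f t|%:E <=
   \int[mu]_(t in A `\` B) `|f t|%:E + \int[mu]_(t in B `\` A) `|f t|%:E)%E.
Proof.
move=> mA mB iA iB.
have mAB : measurable (A `\` B) by exact: measurableD.
have mBA : measurable (B `\` A) by exact: measurableD.
have split_int (C D : set R) : measurable C -> measurable D ->
    mu.-integrable C (EFin \o f) -> \int[mu]_(t in C) f t =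
    \int[mu]_(t in C `\` D) f t + \int[mu]_(t in C `&` D) f t.
  move=> mC mD iC; rewrite addrC -[in LHS](setUIDK C D) Rintegral_setU//.
  - exact: measurableI.
  - exact: measurableD.
  - by rewrite setUIDK.
  - by apply/disj_setPS => t [[_ Dt] [_ /(_ Dt)]].
rewrite (split_int A B)// (split_int B A)// [B `&` A]setIC.
rewrite opprD addrACA subrr addr0.
have bnd (C : set R) : measurable C -> mu.-integrable C (EFin \o f) ->
    (`|\int[mu]_(t in C) f t|%:E <= \int[mu]_(t in C) `|f t|%:E)%E.
  move=> mC iC; rewrite EFin_normr_Rintegral//; apply: le_abse_integral => //.
  by case/integrableP : iC.
apply: (@le_trans _ _ (`|\int[mu]_(t in A `\` B) f t|%:E +
    `|\int[mu]_(t in B `\` A) f t|%:E)%E).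
  by rewrite -EFinD lee_fin ler_normB.
apply: leeD; apply: bnd => //.
- by apply: integrableS iA => //; exact: subDsetl.
- by apply: integrableS iB => //; exact: subDsetl.
Qed.

Lemma ball_setD_sub x y r : x <= y ->
  ball x r `\` ball y r `<=` `[x - r, y - r] /\
  ball y r `\` ball x r `<=` `[x + r, y + r].
Proof.
move=> xy; rewrite !ball_itv; split=> z /= [];
  rewrite /ball_ /= !in_itv/= => /andP[z1 z2] /negP; rewrite negb_and -!leNgt;
  by move=> /orP[?|?]; apply/andP; split; lra.
Qed.

End average.

(** * Uniform bounds and equicontinuity of averages at a fixed radius *)

Section averaging_operators.
Context {R : realType}.
Local Notation mu := (@lebesgue_measure R).
Variables (p w : R -> R) (c : R).
Hypotheses (mp : measurable_fun [set: R] p) (c1 : 1 < c)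
  (cp : forall x, c <= p x).
Hypotheses (mw : measurable_fun [set: R] w) (w0 : forall x, 0 < w x).
Hypothesis wA : Apx p w.

Let lint K f (fK : cells_bounded p w K f) :=
  cells_bounded_locally_integrable mp c1 cp mw w0 wA fK.

Lemma ball_sub_box (x r n : R) m : n + r < m%:R -> `|x| <= n ->
  ball x r `<=` box m.
Proof.
move=> nrm; rewrite ler_norml => /andP[? ?] y.
rewrite ball_itv /box /= !in_itv/= => /andP[? ?]; apply/andP; split; lra.
Qed.

Lemma mu_setD_ball (x y r : R) :
  (mu (ball x r `\` ball y r) <= `|x - y|%:E)%E.
Proof.
have [xy|/ltW yx] := leP x y.
  have [h _] := @ball_setD_sub R x y r xy.
  apply: (@le_trans _ _ (mu `[x - r, y - r]%classic)).
    rewrite le_measure//; apply: mem_set; last exact: measurable_itv.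
    by apply: measurableD; exact: measurable_ball.
  rewrite lebesgue_measure_itv/= lte_fin; case: ifP => _; rewrite ?lee_fin//.
  by rewrite ler0_norm ?subr_le0//; lra.
have [_ h] := @ball_setD_sub R y x r yx.
apply: (@le_trans _ _ (mu `[y + r, x + r]%classic)).
  rewrite le_measure//; apply: mem_set; last exact: measurable_itv.
  by apply: measurableD; exact: measurable_ball.
rewrite lebesgue_measure_itv/= lte_fin; case: ifP => _; rewrite ?lee_fin//.
by rewrite ger0_norm ?subr_ge0//; lra.
Qed.

(** Moving the centre from [x] to [y] changes the domain by two sets of measure at most [|x - y|],
    on which equi-integrability applies. *)
Lemma average_equicontinuous (K n r e : R) : 0 < r -> 0 < e ->
  exists2 d, 0 < d & forall f, cells_bounded p w K f -> forall x y,
    `|x| <= n -> `|y| <= n -> `|x - y| < d ->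
    `|average f x r - average f y r| <= e.
Proof.
move=> r0 e0; have [m nrm] := nat_gt (n + r).
have [d d0 hd] :=
  (* The tolerance is [e * r]: two such errors, divided by the length [2 * r] of the ball, give
     [e]. *)
  cells_bounded_equiintegrable mp c1 cp mw w0 wA K m (mulr_gt0 e0 r0).
exists d => // f fK x y xn yn xyd.
have lf := lint fK.
have mb z : measurable (ball z r : set R) by exact: measurable_ball.
rewrite !averageE// -mulrBr normrM ger0_norm ?invr_ge0 ?mulrn_wge0 ?(ltW r0)//.
rewrite ler_pdivrMl ?pmulrn_lgt0//.
have -> : r *+ 2 * e = e * r + e * r by ring.
rewrite -lee_fin; apply: le_trans (Rintegral_subset_bound (mb x) (mb y)
  (locally_integrable_ball x r lf) (locally_integrable_ball y r lf)) _.
rewrite EFinD; apply: leeD; apply: hd => //; try exact: measurableD.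
- exact: subset_trans (@subDsetl _ _ _) (ball_sub_box nrm xn).
- by apply: le_lt_trans (mu_setD_ball _ _ _) _; rewrite lte_fin.
- exact: subset_trans (@subDsetl _ _ _) (ball_sub_box nrm yn).
- by apply: le_lt_trans (mu_setD_ball _ _ _) _; rewrite lte_fin distrC.
Qed.

Lemma average_bounded (K n r : R) : 0 < r ->
  exists L, forall f, cells_bounded p w K f -> forall x,
    `|x| <= n -> `|average f x r| <= L.
Proof.
move=> r0; have [m nrm] := nat_gt (n + r).
have [L L0 hL] := cells_bounded_L1 mp c1 cp mw w0 wA K m.
exists ((r *+ 2)^-1 * L) => f fK x xn.
rewrite -lee_fin; apply: le_trans (normr_average_le x (lint fK) r0) _.
rewrite /iavg lebesgue_measure_ball ?(ltW r0)//.
rewrite EFinM inver mulrn_eq0/= gt_eqF//=.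
apply: lee_wpmul2l; first by rewrite lee_fin invr_ge0 mulrn_wge0// ltW.
apply: le_trans (hL _ fK); apply: ge0_subset_integral => //.
- exact: measurable_ball.
- exact: measurable_box.
- apply/measurable_funTS/measurable_EFinP/measurableT_comp => //.
  by case: fK.
- exact: ball_sub_box nrm xn.
Qed.

Lemma measurable_average K f r : cells_bounded p w K f ->
  measurable_fun [set: R] (average f ^~ r).
Proof.
move=> fK; have [r0|r0] := leP r 0.
  rewrite (_ : average f ^~ r = cst 0)//; apply/funext => x.
  exact: average_le0.
apply: continuous_measurable_fun => x; apply/cvgrPdist_le => /= e e0.
(* For positive [r] the average is continuous; the margin 1 keeps points near [x] within the range
   of uniformity. *)
have [d d0 hd] := average_equicontinuous K (`|x| + 1) r0 e0.
have m0 : 0 < Num.min 1 d by rewrite lt_min ltr01.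
apply: filterS (nbhsx_ballx x _ m0) => y.
rewrite /ball/= lt_min => /andP[xy1 xyd]; apply: hd => //.
  by rewrite lerDl.
rewrite -(subrK x y) (le_trans (ler_normD _ _))// addrC lerD2l.
by rewrite distrC ltW.
Qed.

End averaging_operators.

(** * Total boundedness in the amalgam space *)

Section compactness.
Context {R : realType}.
Local Notation mu := (@lebesgue_measure R).
Local Open Scope ereal_scope.
Variables (p w : R -> R) (c P q : R).
Hypotheses (mp : measurable_fun [set: R] p) (c1 : (1 < c)%R)
  (cp : forall x, (c <= p x)%R) (pP : forall x, (p x <= P)%R).
Hypotheses (w_weight : weight w) (wA : Apx p w).
Hypothesis q1 : (1 <= q)%R.

Let w0 x : (0 < w x)%R. Proof. by case: w_weight. Qed.

Let mw : measurable_fun [set: R] w. Proof. by case: w_weight => _ []. Qed.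

Let p1 x : (1 <= p x)%R. Proof. exact: le_trans (ltW c1) (cp x). Qed.

Let q_gt0 : (0 < q)%R. Proof. exact: lt_le_trans q1. Qed.

Let mE (f : R -> R) : measurable_fun [set: R] f ->
  measurable_fun [set: R] (EFin \o f).
Proof. by move=> mf; exact/measurable_EFinP. Qed.

Definition centered (n : R) : set R := [set x | (`|x| <= n)%R].

Lemma measurable_centered n : measurable (centered n).
Proof.
rewrite (_ : centered n = `[(- n)%R, n]%classic); first exact: measurable_itv.
by apply/seteqP; split => x /=; rewrite /centered/= in_itv/= ler_norml.
Qed.

Lemma measurable_restrict_tail n (h : R -> R) : measurable_fun [set: R] h ->
  measurable_fun [set: R] ((EFin \o h) \_ [set x : R | (n < `|x|)%R]).
Proof.
move=> mh; apply/(measurable_restrictT _ _).1.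
  rewrite (_ : [set x : R | _] = ~` centered n).
    by apply: measurableC; exact: measurable_centered.
  by apply/seteqP; split => x /=; rewrite /centered/= ltNge => /negP.
by apply: measurable_funTS; exact: mE.
Qed.

(** Only finitely many cells meet [centered n], and in each of them local integrability of [w]
    bounds the norm. *)
Lemma amalgam_norm_indic_lty n :
  amalgam_norm p q w (cst 1 \_ (centered n)) < +oo.
Proof.
have [m nm] := nat_gt (n + 1)%R.
pose G : R -> \bar R := cst 1 \_ (centered n).
have mG : measurable_fun [set: R] G.
  apply/(measurable_restrictT _ _).1; first exact: measurable_centered.
  exact: measurable_cst.
(* The indices from [-m] to [m - 1]; since [n + 1 < m], every cell meeting [centered n] is among
   them. *)
pose A : set int := [set (i%:Z - m%:Z)%R | i in `I_(m + m)].
have finA : finite_set A by exact/finite_image/finite_II.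
rewrite -/G /amalgam_norm; apply: poweR_lty.
rewrite (esumID A) ?setTI; last by move=> k _; exact: poweR_ge0.
rewrite [X in _ + X]esum1 ?adde0; last first.
  move=> k /= kA; rewrite (_ : G \_ _ = cst 0).
    by rewrite wnorm0// poweR0r// gt_eqF.
  apply/funext => x; rewrite /patch; case: ifP => // /set_mem.
  rewrite /unit_cell/= in_itv/= => /andP[kx xk].
  rewrite /G /patch; case: ifPn => // /set_mem; rewrite /centered/= ler_norml.
  move=> /andP[nx xn]; exfalso; apply: kA.
  have km : (k < m%:Z)%R.
    by rewrite -(@ltr_int R) -[ltRHS]/(m%:R)%R; lra.
  have mk : (- m%:Z <= k)%R.
    rewrite -(@ler_int R) mulrNz -[X in (- X)%R]/(m%:R)%R.
    by move: xk; rewrite intrD; lra.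
  have km0 : (0 <= k + m%:Z)%R by rewrite -lerBlDr sub0r.
  exists (absz (k + m%:Z)%R); last by rewrite gez0_abs// addrK.
  by rewrite /= -ltz_nat gez0_abs// PoszD ltrD2r.
rewrite esum_fset//; last by move=> k _; exact: poweR_ge0.
rewrite fsbig_finite//=; apply: lte_sum_pinfty => k _; apply: poweR_lty.
pose I := \int[mu]_(x in `[k%:~R%R, (k + 1)%:~R%R]) `|w x|%:E.
have Ioo : I < +oo.
  by case: w_weight => _ [_ _]; apply=> //; exact: segment_compact.
(* As [l >= 1] and [p >= 1], [l^(-p) <= l^-1]; hence the modular at [l] is at most [I / l <= 1]. *)
pose l := Num.max 1%R (fine I).
have l1 : (1 <= l)%R by rewrite le_max lexx.
have l0 : (0 < l)%R by exact: lt_le_trans l1.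
apply: (@le_lt_trans _ _ l%:E); last exact: ltry.
apply: (wnorm_le_modular p1 w0) => //.
apply: (@le_trans _ _ (\int[mu]_(x in `[k%:~R%R, (k + 1)%:~R%R])
   ((l^-1)%:E * `|w x|%:E))).
  rewrite [leRHS]integral_mkcond; apply: ge0_le_integral => //.
  - by move=> x _; exact: modular_density_ge0.
  - by apply: measurable_modular_density => //; exact: measurable_restrict_cell.
  - apply/(measurable_restrictT _ _).1; first exact: measurable_itv.
    apply: measurable_funTS; apply: measurable_funeM; apply: mE.
    exact: measurableT_comp.
  move=> x _; rewrite modular_density_restrict// /modular_density /patch.
  case: ifPn => [/set_mem xk|_]; last first.
    by case: ifP => // _; rewrite mule_ge0// lee_fin invr_ge0 ltW.
  rewrite ifT; last first.
    apply: mem_set; move: xk; rewrite /unit_cell/= !in_itv/= => /andP[-> ?].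
    exact: ltW.
  rewrite ger0_norm ?(ltW (w0 x))//; apply: lee_wpmul2r.
    by rewrite lee_fin ltW.
  apply: (@le_trans _ _ ((l^-1)%:E `^ p x)).
    apply: poweR_le; first exact: le_trans (p1 x).
      by rewrite mule_ge0// lee_fin invr_ge0 ltW.
    rewrite -[leRHS]mul1e; apply: lee_wpmul2r.
      by rewrite lee_fin invr_ge0 ltW.
    by rewrite /G /patch; case: ifP => _; rewrite /= lee_fin ?normr1 ?normr0.
  by apply: poweR_le_self => //; rewrite lee_fin ?invr_ge0 ?(ltW l0)// invf_le1.
rewrite ge0_integralZl_EFin ?invr_ge0 ?(ltW l0)//; last first.
  by apply: measurable_funTS; apply: mE; exact: measurableT_comp.
rewrite -/I -(@fineK _ I); last first.
  by rewrite ge0_fin_numE// integral_ge0.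
by rewrite -EFinM lee_fin mulrC ler_pdivrMr// mul1r le_max lexx orbT.
Qed.

(** Dominated convergence along the constants [1/(i+1)] on [centered n] yields a constant of small
    norm, to which [h] is compared. *)
Lemma amalgam_norm_small_indic n e : (0 < e)%R -> exists2 d, (0 < d)%R &
  forall h : R -> R, measurable_fun [set: R] h ->
    (forall x, centered n x -> `|h x| <= d)%R ->
    amalgam_norm p q w ((EFin \o h) \_ (centered n)) <= e%:E.
Proof.
move=> e0.
have mind k : measurable_fun [set: R]
    ((cst k%:E : R -> \bar R) \_ (centered n)).
  apply/(measurable_restrictT _ _).1; first exact: measurable_centered.
  exact: measurable_cst.
have := @amalgam_norm_dominated_convergence R p w P q mp p1 pP mw w0 q1
  (fun i => cst (i.+1%:R^-1)%:E \_ (centered n)) (cst 1 \_ (centered n)) e.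
move=> /(_ (fun i => mind _) (mind _)) [].
- move=> i x; rewrite /patch; case: ifP => //= _.
  by rewrite lee_fin !ger0_norm// invf_le1// ler1n.
- apply: aeW => x; rewrite /patch; case: (x \in _); last exact: cvg_cst.
  apply/cvg_EFin; first exact: nearW.
  exact: (@cvg_harmonic R).
- exact: amalgam_norm_indic_lty.
- exact: e0.
move=> i _ hi; have {}hi := hi i (leqnn i).
exists (i.+1%:R^-1)%R; first by rewrite invr_gt0.
move=> h mh hd.
apply: le_trans hi; apply: (amalgam_norm_le mp p1 mw w0 q1).
- apply/(measurable_restrictT _ _).1; first exact: measurable_centered.
  by apply: measurable_funTS; exact: mE.
- exact: mind.
- move=> x; rewrite /patch; case: ifPn => // /set_mem xn /=.
  by rewrite lee_fin (le_trans (hd x xn))// ler_norm.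
Qed.

Hypothesis HM : HL_bounded_on_amalgam p q w.

Local Notation norm := (amalgam_norm p q w).
Local Notation T r f := (fun x => average f x r).

Lemma amalgam_measurable f : amalgam p q w f -> measurable_fun [set: R] f.
Proof. by case. Qed.

Lemma amalgam_cells_bounded K f : amalgam p q w f ->
  norm (EFin \o f) < K%:E -> cells_bounded p w K f.
Proof.
move=> fA fK; split => [|k]; first exact: amalgam_measurable.
exact: le_lt_trans (wnorm_cell_le p w q1 _ k) fK.
Qed.

Lemma amalgam_exists_cells_bounded f : amalgam p q w f ->
  exists K, cells_bounded p w K f.
Proof.
move=> fA; have [_ _ foo] := fA.
have [K _ fK] := ge0_lty_EFin (amalgam_norm_ge0 p w q _) foo.
by exists K; exact: amalgam_cells_bounded.
Qed.

Lemma amalgam_locally_integrable f : amalgam p q w f ->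
  locally_integrable [set: R] f.
Proof.
move=> /amalgam_exists_cells_bounded[K fK].
exact: (cells_bounded_locally_integrable mp c1 cp mw w0 wA fK).
Qed.

Lemma amalgam_measurable_average f r : amalgam p q w f ->
  measurable_fun [set: R] (T r f).
Proof.
move=> /amalgam_exists_cells_bounded[K fK].
exact: (measurable_average mp c1 cp mw w0 wA r fK).
Qed.

Let quasi := amalgam_norm_quasi_triangle mp p1 mw w0 q1.

(** Needed to apply the boundedness of the maximal operator to [f - g]. *)
Lemma amalgamB f g : amalgam p q w f -> amalgam p q w g ->
  amalgam p q w (fun x => (f x - g x)%R).
Proof.
move=> [mf fK foo] [mg gK goo].
have mfg : measurable_fun [set: R] (fun x => f x - g x)%R.
  exact: measurable_funB.
have fgD x : `|(EFin \o (fun x => f x - g x)%R) x| <=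
    `|(EFin \o f) x| + `|(EFin \o g) x|.
  by rewrite /= -EFinD lee_fin ler_normB.
split; first exact: mfg.
  move=> K cK; have mK := compact_measurable cK.
  have mr (h : R -> R) : measurable_fun [set: R] h ->
      measurable_fun [set: R] ((EFin \o h) \_ K).
    move=> mh; apply/(measurable_restrictT _ _).1 => //.
    by apply: measurable_funTS; exact: mE.
  have [a a0 fa] := ge0_lty_EFin (wnorm_ge0 p w _) (fK K cK).
  have [b b0 gb] := ge0_lty_EFin (wnorm_ge0 p w _) (gK K cK).
  have h := wnorm_quasi_triangle mp p1 mw w0 (mr _ mfg) (mr _ mf) (mr _ mg)
    (le_abse_restrict K fgD).
  apply: le_lt_trans (h (Num.max a b) _ _) (ltry _).
    by apply: le_trans (ltW fa) _; rewrite lee_fin le_max lexx.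
  by apply: le_trans (ltW gb) _; rewrite lee_fin le_max lexx orbT.
have [a a0 fa] := ge0_lty_EFin (amalgam_norm_ge0 p w q _) foo.
have [b b0 gb] := ge0_lty_EFin (amalgam_norm_ge0 p w q _) goo.
apply: le_lt_trans
  (quasi (e := Num.max a b) (mE mfg) (mE mf) (mE mg) fgD _ _) (ltry _).
  by apply: le_trans (ltW fa) _; rewrite lee_fin le_max lexx.
by apply: le_trans (ltW gb) _; rewrite lee_fin le_max lexx orbT.
Qed.

Lemma maximal_amalgam_norm_le : exists2 C : R, (0 < C)%R &
  forall f (e : R), amalgam p q w f -> norm (EFin \o f) <= e%:E ->
    norm (HL_maximal f) <= (C * e)%:E.
Proof.
(* The constant in the hypothesis has no prescribed sign; [|C| + 1] is positive and dominates it. *)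
have [C hC] := HM; exists (`|C| + 1)%R; first by rewrite ltr_wpDl.
move=> f e fA fe; apply: le_trans (hC f fA) _.
have := amalgam_norm_ge0 p w q (EFin \o f); move: fe.
case: (norm (EFin \o f)) => [x| |]//; rewrite !lee_fin => xe x0.
apply: (@le_trans _ _ ((`|C| + 1) * x))%R.
  by rewrite ler_wpM2r// (le_trans (ler_norm C))// lerDl.
by rewrite ler_wpM2l// addr_ge0.
Qed.

(** By contradiction: bad radii [r n < 1/(n+1)] form a sequence tending to 0, along which dominated
    convergence and Lebesgue differentiation apply. *)
Lemma average_amalgam_norm_cvg g (e : R) : amalgam p q w g -> (0 < e)%R ->
  exists2 d : R, (0 < d)%R & forall r : R, (0 < r < d)%R ->
    norm (fun x => (g x - average g x r)%:E) <= e%:E.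
Proof.
move=> gA e0; apply: contrapT => nH.
have /choice[r hr] : forall n, exists r : R, (0 < r < n.+1%:R^-1)%R /\
    ~ norm (fun x => (g x - average g x r)%:E) <= e%:E.
  move=> n; apply: contrapT => H; apply: nH.
  exists (n.+1%:R^-1)%R; first by rewrite invr_gt0.
  by move=> r hr; apply: contrapT => H'; apply: H; exists r.
have r0 n : (0 < r n)%R by have [/andP[]] := hr n.
have lg := amalgam_locally_integrable gA.
have mg := amalgam_measurable gA.
have rcvg : r @ \oo --> (0 : R)%R.
  apply: (@squeeze_cvgr _ _ _ _ (cst 0%R) (fun n => n.+1%:R^-1)%R).
  - by apply: nearW => n /=; have [/andP[/ltW -> /ltW ->]] := hr n.
  - exact: cvg_cst.
  - exact: cvg_harmonic.
have mM : measurable_fun [set: R] (HL_maximal g).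
  exact: measurable_HL_maximal.
pose H x := `|g x|%:E + HL_maximal g x.
have M0 := HL_maximalT_ge0 lg.
have mH : measurable_fun [set: R] H.
  by apply: emeasurable_funD => //; apply: mE; exact: measurableT_comp.
have mh n : measurable_fun [set: R] (fun x => (g x - average g x (r n))%:E).
  apply: (mE (f := fun x => g x - average g x (r n))%R).
  by apply: measurable_funB => //; exact: amalgam_measurable_average.
have Hoo : norm H < +oo.
  have [_ _ goo] := gA.
  have [a a0 ga] := ge0_lty_EFin (amalgam_norm_ge0 p w q _) goo.
  have [C C0 hC] := maximal_amalgam_norm_le.
  have Ma := hC g a gA (ltW ga).
  apply: le_lt_trans
  (quasi (e := Num.max a (C * a)%R) mH (mE mg) mM _ _ _) (ltry _).
  - by move=> x; rewrite /H gee0_abs ?(gee0_abs (M0 _)) ?adde_ge0 ?lee_fin.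
  - by apply: le_trans (ltW ga) _; rewrite lee_fin le_max lexx.
  - by apply: le_trans Ma _; rewrite lee_fin le_max lexx orbT.
have [] := @amalgam_norm_dominated_convergence R p w P q mp p1 pP mw w0 q1 _ H
  e mh mH _ _ Hoo e0.
- move=> n x; rewrite [leRHS]gee0_abs ?adde_ge0 ?lee_fin//.
  rewrite /H /=; apply: (@le_trans _ _ (`|g x|%:E + `|average g x (r n)|%:E)).
    by rewrite -EFinD lee_fin ler_normB.
  by apply: leeD => //; exact: normr_average_le_maximal.
- apply: (@filterS _ _ (ae_filter_ringOfSetsType mu) _ _ _
    (lebesgue_differentiation lg)) => x gx.
  exact: cvg_average.
by move=> n _ /(_ n (leqnn n)); have [_] := hr n.
Qed.

Lemma restrict_gt_amalgam_norm_cvg g (e : R) : amalgam p q w g -> (0 < e)%R ->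
  \forall n \near \oo,
    norm ((EFin \o g) \_ [set x : R | (n%:R < `|x|)%R]) <= e%:E.
Proof.
move=> gA e0; have [_ _ goo] := gA; have mg := amalgam_measurable gA.
apply: (@amalgam_norm_dominated_convergence R p w P q mp p1 pP mw w0 q1 _
  (EFin \o g) e _ (mE mg) _ _ goo e0).
- by move=> n; exact: measurable_restrict_tail.
- by move=> n x; rewrite /patch; case: ifP => //= _; rewrite normr0 lee_fin.
- apply: aeW => x; apply: cvg_near_cst.
  have [m xm] := nat_gt `|x|%R; exists m => // n /= mn.
  rewrite /patch ifF//; apply/negbTE/negP => /set_mem/=.
  by apply/negP; rewrite -leNgt (le_trans (ltW xm))// ler_nat.
Qed.

Lemma totally_bounded_norm_bounded (F : set (R -> R)) :
  F `<=` amalgam p q w -> totally_bounded_amalgam p q w F ->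
  ereal_sup [set norm (EFin \o f) | f in F] < +oo.
Proof.
move=> FA tbF; have [N [finN NA netN]] := tbF 1%R ltr01.
(* A single [K] bounding the norms of all elements of the finite net. *)
have : \forall K \near +oo%R, forall g, N g -> norm (EFin \o g) <= K%:E.
  apply: near_finite_set => // g /NA[_ _ goo].
  have [K K0 gK] := ge0_lty_EFin (amalgam_norm_ge0 p w q _) goo.
  apply: filterS (nbhs_pinfty_ge (num_real K)) => K' KK'.
  by apply: le_trans (ltW gK) _; rewrite lee_fin.
move=> /filter_ex[K NK].
apply: (@le_lt_trans _ _ (8 * Num.max 1%R K)%:E); last exact: ltry.
apply: ge_ereal_sup => _ [f Ff <-].
have [g Ng fg] := netN f Ff.
have mf := amalgam_measurable (FA f Ff).
have mg := amalgam_measurable (NA g Ng).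
apply: (quasi (g1 := fun x => (f x - g x)%:E) (g2 := EFin \o g)) => //.
- exact: mE.
- apply: (mE (f := fun x => f x - g x)%R); exact: measurable_funB.
- exact: mE.
- by move=> x /=; rewrite -EFinD lee_fin -{1}(subrK (g x) (f x)) ler_normD.
- by apply: le_trans (ltW fg) _; rewrite lee_fin le_max lexx.
- by apply: le_trans (NK g Ng) _; rewrite lee_fin le_max lexx orbT.
Qed.

Lemma totally_bounded_tail (F : set (R -> R)) :
  F `<=` amalgam p q w -> totally_bounded_amalgam p q w F ->
  forall eps : R, (0 < eps)%R -> exists2 gamma : R, (0 < gamma)%R &
    forall f, F f ->
      norm ((EFin \o f) \_ [set x : R | (gamma < `|x|)%R]) < eps%:E.
Proof.
move=> FA tbF eps eps0.
(* The quasi-triangle inequality turns [eps / 16] into [eps / 2], which is strictly below [eps]. *)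
have e0 : (0 < eps / 16)%R by rewrite divr_gt0.
have [N [finN NA netN]] := tbF _ e0.
have : \forall n \near \oo, forall g, N g ->
    norm ((EFin \o g) \_ [set x : R | (n%:R < `|x|)%R]) <= (eps / 16)%:E.
  by apply: near_finite_set => // g /NA gA; exact: restrict_gt_amalgam_norm_cvg.
case=> n _ hn; have {}hn := hn n.+1 (leqnSn n).
exists n.+1%:R%R; first by rewrite ltr0n.
move=> f Ff; have [g Ng fg] := netN f Ff.
have mf := amalgam_measurable (FA f Ff).
have mg := amalgam_measurable (NA g Ng).
have mr := @measurable_restrict_tail n.+1%:R.
apply: (@le_lt_trans _ _ (8 * (eps / 16))%:E); last by rewrite lte_fin; lra.
apply: (quasi (g1 := fun x => (f x - g x)%:E)
  (g2 := (EFin \o g) \_ [set x : R | (n.+1%:R < `|x|)%R])).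
- exact: mr.
- apply: (mE (f := fun x => f x - g x)%R); exact: measurable_funB.
- exact: mr.
- move=> x; rewrite /patch; case: ifP => _ /=; last first.
    by rewrite normr0 -EFinD lee_fin addr_ge0.
  by rewrite -EFinD lee_fin -{1}(subrK (g x) (f x)) ler_normD.
- exact: ltW.
- exact: hn.
Qed.

(** With [g] in the net, [f - (f)_B = (f - g) + (g - (g)_B) - (f - g)_B], and the last term is
    dominated by the maximal function of [f - g]. *)
Lemma totally_bounded_average (F : set (R -> R)) :
  F `<=` amalgam p q w -> totally_bounded_amalgam p q w F ->
  forall eps : R, (0 < eps)%R -> exists2 delta : R, (0 < delta)%R &
    forall r : R, (0 < r < delta)%R -> forall f, F f ->
      norm (fun x => (f x - average f x r)%:E) < eps%:E.
Proof.
move=> FA tbF eps eps0.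
have [C C0 hC] := maximal_amalgam_norm_le.
(* At least 1 and at least [C], so [D * e] bounds both norms entering that of [v]. *)
pose D := (C + 1)%R; have D0 : (0 < D)%R by rewrite addr_gt0.
have CD : (C <= D)%R by rewrite lerDl.
have D1 : (1 <= D)%R by rewrite lerDr ltW.
(* Two nested quasi-triangle inequalities cost 64, and [64 * D * e = eps / 2]. *)
pose e := (eps / (128 * D))%R.
have e0 : (0 < e)%R by rewrite divr_gt0// mulr_gt0.
have [N [finN NA netN]] := tbF _ e0.
have : \forall r \near (0%R : R)^'+, forall g, N g ->
    norm (fun x => (g x - average g x r)%:E) <= e%:E.
  apply: near_finite_set => // g /NA gA.
  have [d d0 hd] := average_amalgam_norm_cvg gA e0.
  near=> r; apply: hd; apply/andP; split; near: r.
    exact: nbhs_right_gt.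
  exact: nbhs_right_lt.
case=> d /= d0 hd; exists d => // r /andP[r0 rd] f Ff.
have [g Ng fg] := netN f Ff.
have fA := FA f Ff; have gA := NA g Ng.
have mf := amalgam_measurable fA; have mg := amalgam_measurable gA.
have mTf := amalgam_measurable_average r fA.
have mTg := amalgam_measurable_average r gA.
have lf := amalgam_locally_integrable fA.
have lg := amalgam_locally_integrable gA.
have fgA := amalgamB fA gA.
have lfg := amalgam_locally_integrable fgA.
have mfg : measurable_fun [set: R] (fun x => (f x - g x)%:E).
  by apply: (mE (f := fun x => f x - g x)%R); exact: measurable_funB.
have mgT : measurable_fun [set: R] (fun x => (g x - average g x r)%:E).
  apply: (mE (f := fun x => g x - average g x r)%R).
  exact: (measurable_funB mg mTg).
have mfT : measurable_fun [set: R] (fun x => (f x - average f x r)%:E).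
  apply: (mE (f := fun x => f x - average f x r)%R).
  exact: (measurable_funB mf mTf).
have mM : measurable_fun [set: R] (HL_maximal (fun x => f x - g x)%R).
  exact: measurable_HL_maximal.
have M0 := HL_maximalT_ge0 lfg.
pose v x := `|(g x - average g x r)%:E| + HL_maximal (fun x => f x - g x)%R x.
have mv : measurable_fun [set: R] v.
  by apply: emeasurable_funD => //; exact: measurableT_comp.
have v0 x : 0 <= v x by rewrite adde_ge0.
have hgT : norm (fun x => (g x - average g x r)%:E) <= e%:E.
  by apply: hd => //=; rewrite sub0r normrN gtr0_norm.
have hv : norm v <= (8 * (D * e))%:E.
  apply: (quasi mv mgT mM).
  - by move=> x; rewrite (gee0_abs (v0 x)) (gee0_abs (M0 x)).
  - by apply: le_trans hgT _; rewrite lee_fin ler_peMl// ltW.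
  - apply: le_trans (hC _ e fgA (ltW fg)) _.
    by rewrite lee_fin ler_wpM2r// ltW.
apply: (@le_lt_trans _ _ (8 * (8 * (D * e)))%:E); last first.
  rewrite lte_fin /e (_ : 8 * (8 * (D * (eps / (128 * D)))) = eps / 2)%R.
    by rewrite ltr_pdivrMr// ltr_pMr// ltr1n.
  by field; rewrite gt_eqF.
apply: (quasi mfT mfg mv); last exact: hv; last first.
  apply: le_trans (ltW fg) _; rewrite lee_fin.
  have De : (e <= D * e)%R by rewrite ler_peMl// ltW.
  have De0 : (0 <= D * e)%R by rewrite mulr_ge0 ?(ltW D0)// ltW.
  lra.
move=> x; rewrite (gee0_abs (v0 x)) /v.
apply: (@le_trans _ _ (`|(f x - g x)%:E| + (`|(g x - average g x r)%:E| +
    `|average (fun x => f x - g x)%R x r|%:E))).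
  rewrite averageB// /= -!EFinD lee_fin.
  have -> : (f x - average f x r = (f x - g x) + ((g x - average g x r) -
     (average f x r - average g x r)))%R by ring.
  apply: le_trans (ler_normD _ _) _; rewrite lerD2l; exact: ler_normB.
by apply: leeD => //; apply: leeD => //; exact: normr_average_le_maximal.
Unshelve. all: by end_near. Qed.

Lemma average_finite_code (K n r e : R) : (0 < n)%R -> (0 < r)%R -> (0 < e)%R ->
  exists (I : finType) (Phi : (R -> R) -> I), forall f g,
    cells_bounded p w K f -> cells_bounded p w K g -> Phi f = Phi g ->
    forall x, centered n x -> (`|average f x r - average g x r| <= e)%R.
Proof.
move=> n0 r0 e0; have e30 : (0 < e / 3)%R by rewrite divr_gt0.
have [d d0 hd] := average_equicontinuous mp c1 cp mw w0 wA K n r0 e30.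
have [L hL] := average_bounded mp c1 cp mw w0 wA K n r0.
(* A grid of step [d] starting at [-n]: each [x] in [centered n] is within [d] of the grid point at
   or just before it. *)
pose pt (j : nat) := (- n + j%:R * d)%R.
pose m := Num.truncn ((n + n) / d)%R.
(* Shifted by [L] to be nonnegative and measured in units of [e / 3], so that equal integer parts
   mean averages within [e / 3]. *)
pose v f j := ((average f (pt j) r + L) / (e / 3))%R.
pose M := Num.truncn ((L + L) / (e / 3))%R.
exists {ffun 'I_m.+1 -> 'I_M.+1},
  (* Out of range [inord] returns 0 and loses information; for functions satisfying [cells_bounded],
     [v_le] shows that this does not happen. *)
  (fun f => [ffun j : 'I_m.+1 => inord (Num.truncn (v f j))]).
move=> f g fK gK fg x; rewrite /centered/= => xn.
have /andP[nx xn'] : (- n <= x <= n)%R by rewrite -ler_norml.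
have xd0 : (0 <= (x + n) / d)%R by rewrite divr_ge0 ?(ltW d0)//; lra.
pose j := Num.truncn ((x + n) / d)%R.
have jm : (j < m.+1)%N.
  by rewrite ltnS; apply: le_truncn; rewrite ler_pM2r ?invr_gt0//; lra.
have /andP[j1 j2] : (j%:R <= (x + n) / d < j.+1%:R)%R by exact: truncn_itv.
have {}j1 : (j%:R * d <= x + n)%R by rewrite -ler_pdivlMr.
have {}j2 : (x + n < j%:R * d + d)%R.
  by rewrite -[X in (_ < _ + X)%R]mul1r -mulrDl natr1 -ltr_pdivrMr.
have jd0 : (0 <= j%:R * d)%R by rewrite mulr_ge0// ltW.
have ptn : (`|pt j| <= n)%R by rewrite ler_norml /pt; apply/andP; split; lra.
have xpt : (`|x - pt j| < d)%R by rewrite ltr_norml /pt; apply/andP; split; lra.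
have v_ge0 h : cells_bounded p w K h -> (0 <= v h j)%R.
  move=> hK; rewrite divr_ge0 ?(ltW e30)//.
  by have := hL h hK _ ptn; rewrite ler_norml => /andP[? _]; lra.
have v_le h : cells_bounded p w K h -> (Num.truncn (v h j) < M.+1)%N.
  move=> hK; rewrite ltnS; apply: le_truncn; rewrite ler_pM2r ?invr_gt0//.
  by have := hL h hK _ ptn; rewrite ler_norml => /andP[_ ?]; lra.
have vfg : Num.truncn (v f j) = Num.truncn (v g j).
  have := congr1
    (fun phi : {ffun 'I_m.+1 -> 'I_M.+1} => val (phi (Ordinal jm))) fg.
  by rewrite !ffunE /= !inordK// v_le.
have {vfg} := truncn_eq_dist (v_ge0 f fK) (v_ge0 g gK) vfg.
rewrite -mulrBl normrM [(`|_^-1|)%R]ger0_norm ?invr_ge0 ?(ltW e30)//.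
rewrite ler_pdivrMr// mul1r.
rewrite (_ : (average f (pt j) r + L - (average g (pt j) r + L) =
  average f (pt j) r - average g (pt j) r)%R); last by ring.
exact: normr_distr3 (hd f fK x (pt j) xn ptn xpt) (hd g gK x (pt j) xn ptn xpt).
Qed.

(** Two functions with the same code are compared on [centered n] through their averages, and
    outside it through their tails. *)
Lemma totally_bounded_of_conditions (F : set (R -> R)) :
  F `<=` amalgam p q w ->
  ereal_sup [set norm (EFin \o f) | f in F] < +oo ->
  (forall eps : R, (0 < eps)%R -> exists2 delta : R, (0 < delta)%R &
    forall r : R, (0 < r < delta)%R -> forall f, F f ->
      norm (fun x => (f x - average f x r)%:E) < eps%:E) ->
  (forall eps : R, (0 < eps)%R -> exists2 gamma : R, (0 < gamma)%R &
    forall f, F f ->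
      norm ((EFin \o f) \_ [set x : R | (gamma < `|x|)%R]) < eps%:E) ->
  totally_bounded_amalgam p q w F.
Proof.
move=> FA Fbnd Favg Ftail eps eps0.
(* Three nested quasi-triangle inequalities multiply [e] by 512, leaving [eps / 2]. *)
pose e := (eps / (8 * (8 * (8 * 2))))%R.
have e0 : (0 < e)%R by rewrite divr_gt0// !mulr_gt0.
have [n n0 hn] := Ftail e e0.
have [delta delta0 hdelta] := Favg e e0.
pose r := (delta / 2)%R; have r0 : (0 < r)%R by rewrite divr_gt0.
have {}hdelta f : F f -> norm (fun x => (f x - average f x r)%:E) < e%:E.
  by apply: hdelta; rewrite r0 ltr_pdivrMr// ltr_pMr// ltr1n.
have [K FK] : exists K, forall f, F f -> cells_bounded p w K f.
  have [K K0 supK] : exists2 K : R, (0 < K)%R &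
      ereal_sup [set norm (EFin \o f) | f in F] < K%:E.
    (* The supremum is [-oo] when [F] is empty; the maximum with 0 makes it nonnegative. *)
    have : maxe 0 (ereal_sup [set norm (EFin \o f) | f in F]) < +oo.
      by rewrite gt_max ltry.
    move=> /ge0_lty_EFin[|K K0]; first by rewrite le_max lexx.
    by rewrite gt_max => /andP[_ supK]; exists K.
  exists K => f Ff; apply: amalgam_cells_bounded; first exact: FA.
  by apply: le_lt_trans supK; apply: ereal_sup_ubound; exists f.
have [d d0 hd] := amalgam_norm_small_indic n e0.
have [I [Phi hPhi]] := average_finite_code K n0 r0 d0.
have [] := @finite_type_net I _ F Phi
  (fun f g => norm (fun x => (f x - g x)%:E) < eps%:E).
  move=> f g Ff Fg fg.
  have fA := FA f Ff; have gA := FA g Fg.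
  have mf := amalgam_measurable fA; have mg := amalgam_measurable gA.
  have mTf := amalgam_measurable_average r fA.
  have mTg := amalgam_measurable_average r gA.
  pose u1 x := (f x - average f x r)%:E.
  pose u2 x := (g x - average g x r)%:E.
  have mu1 : measurable_fun [set: R] u1.
    apply: (mE (f := fun x => f x - average f x r)%R).
    exact: (measurable_funB mf mTf).
  have mu2 : measurable_fun [set: R] u2.
    apply: (mE (f := fun x => g x - average g x r)%R).
    exact: (measurable_funB mg mTg).
  have mr := @measurable_restrict_tail n.
  pose u3 := (EFin \o f) \_ [set x : R | (n < `|x|)%R].
  pose u4 := (EFin \o g) \_ [set x : R | (n < `|x|)%R].
  pose h5 x := (average f x r - average g x r)%R.
  have mh5 : measurable_fun [set: R] h5 by exact: (measurable_funB mTf mTg).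
  pose u5 := (EFin \o h5) \_ (centered n).
  have mu5 : measurable_fun [set: R] u5.
    apply/(measurable_restrictT _ _).1; first exact: measurable_centered.
    by apply: measurable_funTS; exact: mE.
  pose v1 x := `|u1 x| + `|u2 x|.
  have mv1 : measurable_fun [set: R] v1.
    by apply: emeasurable_funD; exact: measurableT_comp.
  pose v2 x := `|u3 x| + `|u4 x|.
  have mv2 : measurable_fun [set: R] v2.
    by apply: emeasurable_funD; apply: measurableT_comp => //; exact: mr.
  pose v3 x := `|v1 x| + `|v2 x|.
  have mv3 : measurable_fun [set: R] v3.
    by apply: emeasurable_funD; exact: measurableT_comp.
  have hv1 : norm v1 <= (8 * e)%:E.
    apply: (quasi mv1 mu1 mu2); [|exact/ltW/hdelta|exact/ltW/hdelta].
    by move=> x; rewrite gee0_abs// adde_ge0.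
  have hv2 : norm v2 <= (8 * e)%:E.
    apply: (quasi mv2 (mr _ mf) (mr _ mg)); [|exact/ltW/hn|exact/ltW/hn].
    by move=> x; rewrite gee0_abs// adde_ge0.
  have hv3 : norm v3 <= (8 * (8 * e))%:E.
    apply: (quasi mv3 mv1 mv2 _ hv1 hv2).
    by move=> x; rewrite gee0_abs// adde_ge0.
  (* Weakened from [e] to match the bound on [v3], since [quasi] takes a common bound. *)
  have hu5 : norm u5 <= (8 * (8 * e))%:E.
    apply: le_trans (hd h5 mh5 _) _; last by rewrite lee_fin; lra.
    by apply: hPhi => //; exact: FK.
  apply: (@le_lt_trans _ _ (8 * (8 * (8 * e)))%:E);
    last by rewrite lte_fin /e; lra.
  apply: (quasi _ mv3 mu5 _ hv3 hu5).
    by apply: (mE (f := fun x => f x - g x)%R); exact: measurable_funB.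
  (* For [|x| <= n] the terms [v1] and [u5] suffice; beyond, [v2] alone does. *)
  move=> x; have [xn|xn] := leP `|x|%R n.
    apply: (@le_trans _ _ (v1 x + `|u5 x|)).
      rewrite /v1 /u1 /u2 /u5 /patch mem_set// /h5 /= -!EFinD lee_fin.
      have -> : (f x - g x = (f x - average f x r) - (g x - average g x r) +
        (average f x r - average g x r))%R by ring.
      by apply: le_trans (ler_normD _ _) _; rewrite lerD2r ler_normB.
    apply: leeD => //; rewrite [leRHS]gee0_abs; last by rewrite adde_ge0.
    by rewrite /v3 (@gee0_abs _ (v1 x)) ?adde_ge0// leeDl.
  apply: (@le_trans _ _ (v2 x)).
    by rewrite /v2 /u3 /u4 /patch mem_set//= -EFinD lee_fin ler_normB.
  apply: (@le_trans _ _ `|v3 x|); last by rewrite leeDl.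
  rewrite [leRHS]gee0_abs; last by rewrite adde_ge0.
  by rewrite /v3 (@gee0_abs _ (v2 x)) ?adde_ge0// leeDr.
move=> N [finN NF Nnet]; exists N; split => //.
exact: subset_trans NF FA.
Qed.
End compactness.

Theorem theorem9 (R : realType) (p : R -> R) (q : R) (w : R -> R)
    (Hp : Plog p)
    (Hp_inf : (1 < exponent_inf p)%E)
    (Hp_inf_sup : (exponent_inf p <= exponent_sup p)%E)
    (Hp_sup : (exponent_sup p < +oo)%E)
    (Hq : 1 <= q)
    (Hw : weight w)
    (HwA : Apx p w)
    (HM : HL_bounded_on_amalgam p q w)
    (F : set (R -> R))
    (HF : F `<=` amalgam p q w) :
  totally_bounded_amalgam p q w F <->
  [/\ (ereal_sup [set amalgam_norm p q w (EFin \o f) | f in F] < +oo)%E,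
      forall eps : R, 0 < eps -> exists2 delta : R, 0 < delta &
        forall r : R, 0 < r < delta -> forall f, F f ->
          (amalgam_norm p q w (fun x => (f x - average f x r)%:E) < eps%:E)%E &
      forall eps : R, 0 < eps -> exists2 gamma : R, 0 < gamma &
        forall f, F f ->
          (amalgam_norm p q w
             ((EFin \o f) \_ [set x : R | (gamma < `|x|)%R]) < eps%:E)%E].
Proof.
have [[mp p1] logp] := Hp.
(* From here on the exponent satisfies [c <= p x <= P] at every point, with [c > 1]. *)
have [P pP] := log_holder_bounded logp.
have [c c1 cp] := exponent_inf_gt1 logp Hp_inf.
split=> [tbF|[Fbnd Favg Ftail]].
- split.
  + exact: (totally_bounded_norm_bounded mp c1 cp Hw Hq HF tbF).
  + exact: (totally_bounded_average mp c1 cp pP Hw HwA Hq HM HF tbF).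
  + exact: (totally_bounded_tail mp c1 cp pP Hw Hq HF tbF).
- exact: (totally_bounded_of_conditions mp c1 cp pP Hw HwA Hq HF
    Fbnd Favg Ftail).
Qed.
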